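(* $\displaystyle \mathrm{OPT}(I) = \frac{1}{2} \min_{F\subseteq E'_{\rm in}} \sum_{H\in \mathcal{G}_F} \mathrm{gap}(I_H)$.
   Context: Let $G$ be a $2$-connected outerplanar graph with a fixed outerplane drawing, let $C_{\rm out}$ be the outer face boundary (a simple cycle), and let $E_{\rm in}=E(G)\setminus C_{\rm out}$ be the set of chords of $C_{\rm out}$. Let $M,N$ be perfect matchings of $G$ and $I=(G,M,N)$. $\mathrm{OPT}(I)$ is the minimum $t$ such that there are perfect matchings $M_0=M, M_1,\dots,M_t=N$ with $M_i=M_{i-1}\mathbin{\triangle} C_i$ for some $M_{i-1}$-alternating cycle $C_i$ (a cycle whose edges alternate between $M_{i-1}$ and non-$M_{i-1}$ edges), $i=1,\dots,t$. Let $E'_{\rm in}=E_{\rm in}\cap M\cap N$. For $F\subseteq E'_{\rm in}$, the chords in $F$ divide the inner region of $C_{\rm out}$ into $|F|+1$ regions $R_1,\dots,R_{|F|+1}$; let $G_i$ be the subgraph of $G$ consisting of all vertices and edges in $R_i$ and on its boundary, and $\mathcal{G}_F=\{G_1,\dots,G_{|F|+1}\}$ (each is $2$-connected outerplanar). For $H\in\mathcal{G}_F$, let $I_H=(H, M\cap E(H), N\cap E(H))$. For an instance $J=(H,M_H,N_H)$ with $H$ $2$-connected outerplanar, $\mathrm{gap}(J)$ is defined as follows. Build the tree $H^\ast$: its vertices are the inner faces of $H$ together with a copy $\tilde u^\ast$ of each inner face $u^\ast$ that shares an edge with the outer face; two inner faces are adjacent iff they share a chord, and each such $u^\ast$ is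 adjacent to $\tilde u^\ast$. For each inner face $u^\ast$ touching the outer face, its edges on the outer boundary are either all in $M_H\mathbin{\triangle} N_H$ or none are. Edge lengths: an edge $e^\ast$ crossing chord $e$ has length $|M_H\cap\{e\}|+|N_H\cap\{e\}|$; an edge $u^\ast\tilde u^\ast$ has length $1$ if the outer-boundary edges of $u^\ast$ lie in $M_H\mathbin{\triangle} N_H$ and $0$ otherwise. $\mathrm{gap}(J)$ is the diameter of $H^\ast$ with respect to these lengths (maximum over pairs of vertices of the length of the unique path between them).
   Formalization: The case where G is a chordless even cycle with M ≠ N is excluded: there OPT(I) = 1, but the tree is a single edge of length 1, so gap = 1 and the right-hand side is 1/2, and the stated formula fails. *)

(* Defs.v *)
From HB Require Import structures.
From mathcomp Require Import all_boot all_order all_algebra.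

Set Implicit Arguments.
Unset Strict Implicit.
Unset Printing Implicit Defensive.

(* A finite simple graph together with a convex drawing: the vertices, listed  *)
(* in [circ], are placed in this cyclic order on a circle and every edge (a    *)
(* two-element set of vertices) is drawn as a straight segment. The vertex set *)
(* is a subset of the ambient type T, so that subgraphs have the same type.    *)
Record drawn_graph (T : finType) := DrawnGraph {
  circ : seq T;
  edges : {set {set T}}
}.

Section Graphs.
Variable T : finType.
Implicit Types (G : drawn_graph T) (M N F C : {set {set T}}) (S W : {set T}).

Definition vertices G : {set T} := [set x in circ G].

(* Two segments between points of a circle cross iff their end points          *)
(* alternate along the circle.                                                 *)
Definition noncrossing G : Prop :=
  forall a b u v : T,
    index a (circ G) < index u (circ G) ->
    index u (circ G) < index b (circ G) ->
    index b (circ G) < index v (circ G) ->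
    ~ ([set a; b] \in edges G /\ [set u; v] \in edges G).

Definition outerplane G : Prop :=
  [/\ uniq (circ G),
      forall e, e \in edges G -> #|e| = 2 /\ e \subset vertices G
    & noncrossing G].

Definition connected_on G W : Prop :=
  forall x y, x \in W -> y \in W ->
    connect [rel u v | [&& u \in W, v \in W & [set u; v] \in edges G]] x y.

Definition two_connected G : Prop :=
  2 < #|vertices G| /\
  forall X : {set T}, X \subset vertices G -> #|X| < 2 ->
    connected_on G (vertices G :\: X).

Definition cycle_edges (p : seq T) : {set {set T}} :=
  [set [set x; next p x] | x in p].

(* For a 2-connected outerplane graph, the segments between circularly         *)
(* consecutive vertices are all edges, and they form the outer face boundary.  *)
Definition outer_edges G : {set {set T}} := cycle_edges (circ G).

Definition inner_edges G : {set {set T}} := edges G :\: outer_edges G.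

Definition induced_edges G S : {set {set T}} :=
  [set e in edges G | e \subset S].

(* The order in which a convex polygon with set of corners S visits them.      *)
Definition corners G S : seq T := [seq x <- circ G | x \in S].

(* An inner face of the drawing is a convex polygon, represented by its set S  *)
(* of corners: all its sides are edges, and no edge runs through its interior, *)
(* i.e. every edge between two corners is a side.                              *)
Definition inner_faces G : {set {set T}} :=
  [set S : {set T} | [&& S \subset vertices G, 2 < #|S|
                       & cycle_edges (corners G S) == induced_edges G S]].

Definition perfect_matching G M : Prop :=
  M \subset edges G /\
  forall x, x \in vertices G -> #|[set e in M | x \in e]| = 1.

Definition symdiff (A B : {set {set T}}) : {set {set T}} :=
  (A :\: B) :|: (B :\: A).

(* C is the edge set of a cycle of G in which, at every vertex, exactly one of *)
(* the two incident cycle edges belongs to M.                                  *)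
Definition alternating_cycle G M C : Prop :=
  exists p : seq T,
    [/\ uniq p, 2 < size p, C = cycle_edges p, C \subset edges G
      & forall x, x \in p ->
          ([set x; next p x] \in M) = ([set prev p x; x] \notin M)].

Definition reconfigures_in G M N (t : nat) : Prop :=
  exists Ms : nat -> {set {set T}},
    [/\ Ms 0 = M, Ms t = N,
        forall i, i <= t -> perfect_matching G (Ms i)
      & forall i, i < t -> exists C,
          alternating_cycle G (Ms i) C /\ Ms i.+1 = symdiff (Ms i) C].

Definition is_OPT G M N (t : nat) : Prop :=
  reconfigures_in G M N t /\
  forall t', reconfigures_in G M N t' -> t <= t'.

(* In the tree G*, the node (S, false) is the inner face S, and (S, true) is   *)
(* its copy, which exists when S shares an edge with the outer face.           *)
Definition dual_node : finType := ({set T} * bool)%type.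
Implicit Types (u v : dual_node).

Definition shared_chords G S S' : {set {set T}} :=
  [set e in inner_edges G | (e \subset S) && (e \subset S')].

Definition outer_part G S : {set {set T}} :=
  [set e in outer_edges G | e \subset S].

Definition dual_nodes G : {set dual_node} :=
  [set u | (u.1 \in inner_faces G) && (u.2 ==> (outer_part G u.1 != set0))].

Definition dual_adj G u v : bool :=
  [&& u \in dual_nodes G, v \in dual_nodes G &
      if u.1 == v.1 then u.2 != v.2
      else [&& ~~ u.2, ~~ v.2 & shared_chords G u.1 v.1 != set0]].

(* Two distinct inner faces share at most one chord, so that the sum has at    *)
(* most one term. The outer edges of an inner face are either all in           *)
(* symdiff M N, or all outside of it.                                          *)
Definition dual_length G M N u v : nat :=
  if u.1 == v.1 then nat_of_bool (outer_part G u.1 \subset symdiff M N)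
  else \sum_(e in shared_chords G u.1 v.1)
          (#|M :&: [set e]| + #|N :&: [set e]|).

Fixpoint walk_length G M N u (p : seq dual_node) : nat :=
  if p is v :: p' then dual_length G M N u v + walk_length G M N v p' else 0.

Definition dual_path G u v (p : seq dual_node) : bool :=
  [&& path (dual_adj G) u p, last u p == v & uniq (u :: p)].

(* As G* is a tree, the innermost maximum ranges over a single path; bounding  *)
(* the size of p by the number of all conceivable nodes excludes no path.      *)
Definition gap G M N : nat :=
  \max_(u in dual_nodes G) \max_(v in dual_nodes G)
    \max_(p : {bseq #|dual_node| of dual_node} | dual_path G u v p)
      walk_length G M N u p.

(* The regions into which F divides the interior of the outer cycle are the    *)
(* inner faces of the drawing that consists of this cycle and F.               *)
Definition regions G F : {set {set T}} :=
  inner_faces (DrawnGraph (circ G) (outer_edges G :|: F)).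

(* Regions being convex polygons, the edges drawn in a region or on its        *)
(* boundary are those with both ends among its corners. Distinct regions have  *)
(* distinct sets of corners.                                                   *)
Definition region_graph G S : drawn_graph T :=
  DrawnGraph (corners G S) (induced_edges G S).

Definition gap_sum G M N F : nat :=
  \sum_(S in regions G F)
     (let H := region_graph G S in gap H (M :&: edges H) (N :&: edges H)).

Definition common_chords G M N : {set {set T}} := inner_edges G :&: M :&: N.

Definition min_gap_sum G M N : nat :=
  gap_sum G M N
    [arg min_(F < set0 | F \subset common_chords G M N) gap_sum G M N F].

End Graphs.

(* Main.v *)
Require Import Defs.
From mathcomp Require Import all_boot all_order all_algebra zify.

(* Every perfect matching M colours the inner faces: the colour of a face is    *)
(* the parity of the number of edges of M cutting it off from the closing edge  *)
(* of the outer cycle. A chord is in M iff its two faces have distinct colours, *)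
(* and M is determined by its colouring. Flipping an alternating cycle changes  *)
(* the colours of the faces inside it, a monochromatic subtree of the dual tree *)
(* of faces, and conversely.                                                    *)
(*   Lower bound: cut along the common chords that a sequence never flips. No   *)
(* cycle of the sequence then leaves a region, and as a cycle lies on one side  *)
(* of each of its edges it is crossed at most twice by a path of the dual tree, *)
(* whereas the length of the path counts flips that have to be made.            *)
(*   Upper bound: within a region, take a centre c of the dual tree and let c   *)
(* change its colour at each of k = gap/2 steps, while a face f follows c only  *)
(* at the times i with d_M(c, f) <= i < k - d_N(c, f), where d_M and d_N count  *)
(* separating edges of M and N. Each chord of M on the way to f is then removed *)
(* as early, and each chord of N inserted as late, as possible.                 *)

(** A perfect matching is determined by its colouring of the inner faces ([eq_colour]): two faces
    sharing a chord differ in colour exactly when the chord is matched ([colour_share]), and the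
    colour of a face at the outer cycle decides which of its outer edges are matched
    ([colour_outer]). Reconfiguration thus becomes a game on the dual tree: a move inverts the
    colour on a monochromatic subtree whose boundary is an alternating cycle ([boundary_parity],
    [flip_region]).

    Lower bound ([gap_sum_leq]). Take [F] to be the common chords that stay matched throughout a
    sequence of [t] flips. No flipped cycle visits an end of such a chord, so each cycle is charged
    to at most one region ([cycle_in_region], [sum_region_steps]). Along a path of the dual tree of
    a region, the crossed edges need at least as many flips as the path is long ([dual_length_leq]):
    one for an edge of exactly one matching, two for a common chord outside [F]. One cycle crosses
    the path at most twice ([walk_cross2]), so the gap is at most twice the number of cycles charged
    to the region.

    Upper bound ([reconfigure_cut]). For any [F] of common chords the matchings restrict to perfect
    matchings of the regions ([perfect_region]), which are treated one by one ([reconfigure_lift]).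
    In a region, [k] flips suffice once every face satisfies d_M + d_N <= k from suitable centres of
    the right parity ([reconfigure_from_centres]), and [reconfigure_half_gap] finds centres with 2k
    at most the gap. A lone cycle with complementary matchings has gap 1 but needs a flip; [hchord]
    excludes it. *)

Set Implicit Arguments.
Unset Strict Implicit.
Unset Printing Implicit Defensive.

(** * Sides of a pair of vertices *)

Section Sides.
Variables (T : finType) (G : drawn_graph T).
Implicit Types (e S : {set T}) (x y z : T) (s : bool).

Local Notation V := (vertices G).

Definition position x : nat := index x (circ G).
Local Notation pos := position.

Definition between e z : bool :=
  [exists a in e, exists b in e, pos a < pos z < pos b].

(* The chord e cuts the polygon into two closed parts, which are the two sides *)
(* of e; side true e does not wrap around the end of the list circ G.          *)
Definition side s e : {set T} :=
  [set z in V | (z \in e) || (between e z == s)].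

Definition pair e : bool := (#|e| == 2) && (e \subset V).

Lemma pos_inj x y : x \in V -> pos x = pos y -> x = y.
Proof.
rewrite inE /position => xG pxy; rewrite -(nth_index x xG) pxy nth_index //.
by rewrite -index_mem -pxy index_mem.
Qed.

Lemma pos_eq x y : x \in V -> (x == y) = (pos x == pos y).
Proof.
by move=> xV; apply/eqP/eqP => [-> //|]; apply: pos_inj.
Qed.

Lemma pairP e : reflect (exists a b,
  [/\ e = [set a; b], a \in V, b \in V & pos a < pos b]) (pair e).
Proof.
apply: (iffP andP) => [[/cards2P[a [b [ab ->]]] eV]|].
  have aV : a \in V by apply: (subsetP eV); rewrite !inE eqxx.
  have bV : b \in V by apply: (subsetP eV); rewrite !inE eqxx orbT.
  have [lt|gt|eq] := ltngtP (pos a) (pos b).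
  - by exists a, b.
  - by exists b, a; rewrite setUC.
  - by move: ab; rewrite (pos_inj aV eq) eqxx.
case=> a [b [-> aV bV ab]]; split; last first.
  by apply/subsetP => z; rewrite in_set2 => /orP[] /eqP ->.
by rewrite cards2 (_ : a != b) // pos_eq // neq_ltn ab.
Qed.

Lemma between_set2 a b z : pos a < pos b ->
  between [set a; b] z = (pos a < pos z < pos b).
Proof.
move=> ab; apply/existsP/idP => [[u /andP[uab /existsP[v /andP[vab]]]]|azb].
  move: uab vab; rewrite !inE => /orP[] /eqP -> /orP[] /eqP -> => //; try lia.
exists a; rewrite !inE eqxx /=; apply/existsP; exists b.
by rewrite !inE eqxx orbT.
Qed.

Lemma in_side_set2 s a b z : a \in V -> b \in V -> pos a < pos b -> z \in V ->
  (z \in side s [set a; b]) =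
  [|| pos z == pos a, pos z == pos b | (pos a < pos z < pos b) == s].
Proof.
move=> aV bV ab zV; rewrite inE zV /= between_set2 // !inE orbA.
by rewrite !(pos_eq _ zV).
Qed.

Lemma side_vertices s e : side s e \subset V.
Proof. by apply/subsetP => z; rewrite inE => /andP[]. Qed.

Lemma sub_side s e : pair e -> e \subset side s e.
Proof.
move=> /andP[_ /subsetP eV]; apply/subsetP => z ze.
by rewrite inE eV // ze.
Qed.

Lemma sideI s e z : z \in side s e -> z \in side (~~ s) e -> z \in e.
Proof.
rewrite !inE => /andP[_ /orP[//|/eqP ->]] /andP[_ /orP[//|]].
by case: s.
Qed.

Lemma sideU s e z : z \in V -> z \notin side s e -> z \in side (~~ s) e.
Proof.
move=> zV; rewrite inE zV /= negb_or => /andP[_ ns].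
by rewrite inE zV orbC; case: (between e z) (s) ns => [] [].
Qed.

Lemma pair_inj e e' : pair e -> pair e' -> e \subset e' -> e = e'.
Proof.
move=> /andP[/eqP e2 _] /andP[/eqP e2' _] ee'.
by apply/eqP; rewrite eqEcard ee' e2 e2'.
Qed.

Lemma sub_both_sides s e S : S \subset side s e -> S \subset side (~~ s) e ->
  S \subset e.
Proof.
move=> /subsetP S1 /subsetP S2; apply/subsetP => z zS.
by apply: sideI (S1 _ zS) (S2 _ zS).
Qed.

(** The geometric core: of two distinct chords that do not cross, whatever lies beyond [e] as seen
    from [e'] is on the side of [e'] that contains [e]. With the ends in list order this is linear
    arithmetic on positions. *)
Lemma side_nested s s' e e' : pair e -> pair e' -> e != e' ->
  e' \subset side s e -> e \subset side s' e' -> side (~~ s) e \subset side s'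
    e'.
Proof.
move=> /pairP[a [b [-> aV bV ab]]] /pairP[c [d [-> cV dV cd]]] ne.
move=> /subsetP s1 /subsetP s2; apply/subsetP => z zs.
have zV := subsetP (side_vertices _ _) _ zs; move: zs.
have := s1 c; have := s1 d; have := s2 a; have := s2 b.
rewrite !(set21, set22) !in_side_set2 //.
move=> /(_ isT) hb /(_ isT) ha /(_ isT) hd /(_ isT) hc.
have {ne} : ~~ ((pos a == pos c) && (pos b == pos d)).
  apply: contra ne => /andP[]; rewrite -!pos_eq // => /eqP -> /eqP ->.
  by [].
case: s s' ha hb hc hd {s1 s2} => [] []; lia.
Qed.

End Sides.

Lemma next_nth_mod (T : eqType) (x0 : T) (p : seq T) i : uniq p -> i < size p ->
  next p (nth x0 p i) = nth x0 p (if i.+1 == size p then 0 else i.+1).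
Proof.
move=> Up ip; rewrite next_nth mem_nth // index_uniq //.
case: p Up ip => //= y p _; rewrite ltnS eqSS => ip.
have [->|ne] := eqVneq i (size p); first by rewrite nth_default.
by apply: set_nth_default; rewrite ltn_neqAle ne.
Qed.

(** * Convex polygons with corners on the circle *)

Section Polygons.
Variables (T : finType) (G : drawn_graph T).
Hypothesis Uc : uniq (circ G).
Implicit Types (e S : {set T}) (x y z : T) (s : bool).

Local Notation V := (vertices G).
Local Notation pos := (position G).

Lemma mem_corners S x : S \subset V -> (x \in corners G S) = (x \in S).
Proof.
move=> /subsetP SV; rewrite mem_filter.
by case: (boolP (x \in S)) => // /SV; rewrite inE.
Qed.

Lemma corners_uniq S : uniq (corners G S).
Proof. exact: filter_uniq. Qed.

Lemma size_corners S : S \subset V -> size (corners G S) = #|S|.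
Proof.
move=> SV; rewrite -(card_uniqP (corners_uniq S)).
by apply: eq_card => x; rewrite mem_corners.
Qed.

Lemma corners_sorted S x0 i j : i < j < size (corners G S) ->
  pos (nth x0 (corners G S) i) < pos (nth x0 (corners G S) j).
Proof.
have tr : transitive (relpre pos ltn) by move=> y x z; apply: ltn_trans.
have so : sorted (relpre pos ltn) (corners G S).
  apply: sorted_filter => //.
  apply/(sortedP x0) => k k1; rewrite /= /position !index_uniq ?(ltnW k1) //.
case/andP=> ij js; apply: (sorted_ltn_nth tr x0 so) => //.
by rewrite inE; apply: ltn_trans js.
Qed.

(* The sides of a convex polygon are the pairs of corners that have all its    *)
(* corners on one side.                                                        *)
Lemma cycle_cornersP S e : S \subset V -> 1 < #|S| ->
  reflect [/\ pair G e, e \subset S & exists s, S \subset side G s e]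
          (e \in cycle_edges (corners G S)).
Proof.
move=> SV S2; have szp := size_corners SV; have Up := corners_uniq S.
have x0 : T by case: (pickP (mem S)) S2 => [//|/eq_card0 ->].
have pS x : x \in S = (x \in corners G S) by rewrite mem_corners.
have lt := @corners_sorted S x0.
move: (corners G S) szp Up pS lt => p szp Up pS; rewrite szp => lt.
pose f := nth x0 p; rewrite -/f in lt.
have memf k : k < #|S| -> f k \in S by rewrite pS -szp; apply: mem_nth.
have fP z : z \in S -> exists2 j, j < #|S| & z = f j.
  by rewrite pS -szp => /(nthP x0)[j jp <-]; exists j.
have nextf k : k < #|S| -> next p (f k) = f (if k.+1 == #|S| then 0 else k.+1).
  by rewrite -szp; apply: next_nth_mod.
clearbody f.
have le i j : i <= j < #|S| -> pos (f i) <= pos (f j).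
  move=> ij; have [->//|ne] := eqVneq i j; apply: ltnW; apply: lt; lia.
have inV i : i < #|S| -> f i \in V.
  by move=> ip; apply: (subsetP SV); apply: memf.
apply: (iffP imsetP) => [[x]|[/pairP[a [b [-> aV bV ab]]] abS [s Ss]]].
  rewrite -pS => /fP[i ip ->] ->.
  (* The side that closes the polygon, from its last corner to its first, has all corners on side
     [true]; every other side has them on side [false]. *)
  rewrite nextf //; case: eqP => [last_i|nlast].
    have i0 : 0 < i by lia.
    have lt0 := lt 0 i; split.
    - apply/pairP; exists (f 0), (f i).
      by rewrite setUC inV ?inV ?lt0 //; lia.
    - by apply/subsetP => z; rewrite in_set2 => /orP[] /eqP ->; apply: memf;
      lia.
    exists true; apply/subsetP => z zS; rewrite setUC in_side_set2.
    - have [j jp ->] := fP z zS.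
      have := le 0 j; have := le j i; lia.
    - by apply: inV; lia.
    - exact: inV.
    - apply: lt; lia.
    - exact: (subsetP SV).
  have i1 : i.+1 < #|S| by lia.
  split.
  - by apply/pairP; exists (f i), (f i.+1); rewrite !inV ?lt //; lia.
  - by apply/subsetP => z; rewrite in_set2 => /orP[] /eqP ->; apply: memf.
  exists false; apply/subsetP => z zS; rewrite in_side_set2 ?inV ?lt //;
    try lia.
    have [j jp ->] := fP z zS.
    have := le j i; have := le i.+1 j; lia.
  exact: (subsetP SV).
have /andP[aS bS] : (a \in S) && (b \in S).
  by rewrite !(subsetP abS) // ?set21 ?set22.
have [i ip ia] := fP _ aS; have [j jp jb] := fP _ bS; subst a b.
have ij : i < j.
  rewrite ltnNge; apply/negP => ji; have := le j i; clear -ji ip ab; lia.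
case: s Ss => /subsetP Ss.
  have i0 : i = 0.
    have := Ss (f 0); rewrite memf ?in_side_set2 ?inV //; try lia.
    have := lt 0 i; clear -ip ij ab; lia.
  have j1 : j.+1 = #|S|.
    have := Ss (f #|S|.-1).
    rewrite memf ?in_side_set2 ?inV //; try lia.
    have := lt j #|S|.-1; clear -jp ij ab; lia.
  exists (f j); first by rewrite -pS.
  by rewrite nextf // j1 eqxx -i0 setUC.
have j1 : j = i.+1.
  have := Ss (f i.+1); rewrite memf ?in_side_set2 ?inV //; try lia.
  have := lt i i.+1; have := lt i.+1 j; clear -jp ij ab; lia.
exists (f i); first by rewrite -pS.
rewrite nextf // -j1.
by case: eqP => // ?; lia.
Qed.

Lemma cornersT : corners G V = circ G.
Proof. by apply/all_filterP/allP => x; rewrite inE. Qed.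

Lemma outer_edgesP e : 1 < size (circ G) ->
  reflect (pair G e /\ exists s, V \subset side G s e) (e \in outer_edges G).
Proof.
move=> sz; rewrite /outer_edges -{1}cornersT.
apply: (iffP (@cycle_cornersP V e _ _)) => [//||[]//|[pe ?]].
  by rewrite -size_corners // cornersT.
by split=> //; case/andP: pe.
Qed.

(** The side in question joins the corners nearest to [z] in either direction of the circle. If all
    corners come after [z], or all before it, this is the closing side from the first corner to the
    last. *)
Lemma cycle_beyond S z : S \subset V -> 1 < #|S| -> z \in V -> z \notin S ->
  exists s e, [/\ e \in cycle_edges (corners G S), S \subset side G s e
                & z \notin side G s e].
Proof.
move=> SV S2 zV zS.
have ne x : x \in S -> pos x != pos z.
  move=> xS; rewrite -pos_eq ?(subsetP SV) //.
  by apply: contraNneq zS => <-.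
have [x xS] : exists x, x \in S by apply/set0Pn; rewrite -card_gt0; lia.
pose lo x := (x \in S) && (pos x < pos z).
pose hi x := (x \in S) && (pos x > pos z).
have key a b s : a \in S -> b \in S -> pos a < pos b ->
    (forall y, y \in S -> [|| pos y == pos a, pos y == pos b
       | (pos a < pos y < pos b) == s]) ->
    (pos a < pos z < pos b) = ~~ s ->
  exists s e, [/\ e \in cycle_edges (corners G S), S \subset side G s e
                & z \notin side G s e].
  move=> aS bS ab Ss zs; exists s, [set a; b].
  have aV := subsetP SV _ aS; have bV := subsetP SV _ bS.
  have Sab : S \subset side G s [set a; b].
    by apply/subsetP => y yS; rewrite in_side_set2 ?Ss // (subsetP SV).
  split=> //.
    apply/cycle_cornersP => //; split=> //; last by exists s.
      by apply/pairP; exists a, b.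
    by apply/subsetP => y; rewrite in_set2 => /orP[] /eqP ->.
  rewrite in_side_set2 // zs !(eq_sym (pos z)) !(negbTE (ne _ _)) //.
  by case: (s).
have [a /andP[aS az]|nolo] := pickP lo; last first.
  case: (@arg_minnP _ x (fun y => y \in S) pos xS) => a aS amin;
    case: (@arg_maxnP _ x (fun y => y \in S) pos xS) => b bS bmax.
  have az : pos z < pos a.
    by have := ne _ aS; have := nolo a; rewrite /lo aS; lia.
  apply: (key a b true) => //; last by lia.
    rewrite ltnNge; apply/negP => ba; suff : #|S| <= #|[set a]|.
      by rewrite cards1; lia.
    apply/subset_leq_card/subsetP => y yS;
      rewrite inE (pos_eq _ (subsetP SV _ yS)).
    by have := amin _ yS; have := bmax _ yS; lia.
  move=> y yS.
  have := amin _ yS; have := bmax _ yS; lia.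
have [b /andP[bS bz]|nohi] := pickP hi; last first.
  case: (@arg_minnP _ x (fun y => y \in S) pos xS) => a' aS' amin;
    case: (@arg_maxnP _ x (fun y => y \in S) pos xS) => b bS bmax.
  have bz : pos b < pos z.
    by have := ne _ bS; have := nohi b; rewrite /hi bS; lia.
  apply: (key a' b true) => //; last by lia.
    rewrite ltnNge; apply/negP => ba; suff : #|S| <= #|[set b]|.
      by rewrite cards1; lia.
    apply/subset_leq_card/subsetP => y yS;
      rewrite inE (pos_eq _ (subsetP SV _ yS)).
    by have := amin _ yS; have := bmax _ yS; lia.
  move=> y yS.
  have := amin _ yS; have := bmax _ yS; lia.
have loa : lo a by rewrite /lo aS.
have hib : hi b by rewrite /hi bS.
case: (arg_maxnP pos loa) => a' /andP[aS' az'] amax.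
case: (arg_minnP pos hib) => b' /andP[bS' bz'] bmin.
apply: (key a' b' false) => //.
- exact: ltn_trans az' bz'.
- move=> y yS; have yz := ne _ yS.
  have ya : pos y < pos z -> pos y <= pos a'.
    by move=> lt; apply: amax; rewrite /lo yS.
  have yb : pos z < pos y -> pos b' <= pos y.
    by move=> lt; apply: bmin; rewrite /hi yS.
  clear -yz ya yb az' bz'; lia.
by rewrite az' bz'.
Qed.

End Polygons.

(** * Inner faces *)

(* The properties of a 2-connected outerplane graph that region graphs inherit *)
(* directly from the graph they are cut out of.                               *)
Record outerplanar (T : finType) (G : drawn_graph T) : Prop := Outerplanar {
  circ_uniq : uniq (circ G);
  circ_size : 2 < size (circ G);
  edge_pair : forall e, e \in edges G -> pair G e;
  edge_side : forall e e', e \in edges G -> e' \in edges G ->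
    exists s, e' \subset side G s e;
  outer_sub : outer_edges G \subset edges G
}.

(** For an edge [e] and a face [S], exactly one side of [e] contains [S] ([face_side],
    [inside_neq]), so this boolean names that side. *)
Definition inside (T : finType) (G : drawn_graph T) (e S : {set T}) : bool :=
  S \subset side G true e.

Section Faces.
Variables (T : finType) (G : drawn_graph T).
Implicit Types (e S : {set T}) (x y z : T) (s : bool).

Lemma big_not_sub e S : pair G e -> 2 < #|S| -> ~ S \subset e.
Proof. by case/andP=> /eqP e2 _ S3 /subset_leq_card; rewrite e2; lia. Qed.

Lemma inside_side s e S : pair G e -> 2 < #|S| -> S \subset side G s e ->
  inside G e S = s.
Proof.
move=> pe S3; case: s => Ss //.
apply/negbTE/negP => St; apply: (big_not_sub pe S3).
exact: sub_both_sides St Ss.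
Qed.

Hypothesis hG : outerplanar G.

Local Notation V := (vertices G).
Local Notation E := (edges G).
Local Notation side := (side G).
Local Notation inside := (inside G).
Local Notation faces := (inner_faces G).

Let Uc := circ_uniq hG.
Let ep := edge_pair hG.

Lemma outerP e : reflect (pair G e /\ exists s, V \subset side s e)
  (e \in outer_edges G).
Proof. by apply: outer_edgesP => //; apply: ltnW; apply: circ_size hG. Qed.

Lemma faceP S : reflect [/\ S \subset V, 2 < #|S| &
    forall e, pair G e -> e \subset S ->
      e \in E <-> exists s, S \subset side s e] (S \in faces).
Proof.
rewrite inE; apply: (iffP and3P) => -[SV S3 ES]; split=> //;
  have cP e := @cycle_cornersP _ _ Uc S e SV (ltnW S3).
  move=> e pe eS; have <- : (e \in induced_edges G S) = (e \in E).
    by rewrite inE eS andbT.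
  rewrite -(eqP ES); split=> [/cP[]//|Ss].
  by apply/cP.
apply/eqP/setP => e; apply/cP/idP.
  by case=> pe eS Ss; rewrite inE eS andbT; apply/ES.
by rewrite inE => /andP[eE eS]; split; rewrite ?ep //; apply/ES => //;
  apply: ep.
Qed.

Lemma face_vertices S : S \in faces -> S \subset V.
Proof. by case/faceP. Qed.

Lemma face_card S : S \in faces -> 2 < #|S|.
Proof. by case/faceP. Qed.

Lemma face_beyond S z : S \in faces -> z \in V -> z \notin S ->
  exists s e, [/\ e \in E, e \subset S, S \subset side s e & z \notin side s e].
Proof.
move=> fS zV zS; have [SV S3 ES] := faceP _ fS.
have [s [e [eC Ss zs]]] := cycle_beyond Uc SV (ltnW S3) zV zS.
exists s, e; have /(cycle_cornersP Uc _ SV (ltnW S3))[pe eS _] := eC.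
by split=> //; apply/ES => //; exists s.
Qed.

(** If [e] is not a side of [S], one of its ends is beyond some side [f] of [S]. Edges do not cross,
    so all of [e] is on the far side of [f], and the near side of [f], with [S] in it, nests into
    one side of [e]. *)
Lemma face_side S e : S \in faces -> e \in E -> S \subset side (inside e S) e.
Proof.
move=> fS eE; suff [s Ss] : exists s, S \subset side s e.
  by rewrite (inside_side (ep eE) (face_card fS) Ss).
have [SV S3 ES] := faceP _ fS.
have [eS|/subsetPn[z ze zS]] := boolP (e \subset S); first by apply/ES/eE/eS/ep.
have zV : z \in V by case/andP: (ep eE) => _ /subsetP; apply.
have [s [f [fE fsub Ss zs]]] := face_beyond fS zV zS.
have [s1 es1] := edge_side hG fE eE.
have s1E : s1 = ~~ s.
  by case: s1 s es1 zs {Ss} => [] [] // /subsetP/(_ _ ze) ->.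
have [s' fs'] := edge_side hG eE fE.
have ef : f != e by apply: contraTneq ze => <-; apply: contra zS; apply/subsetP.
exists s'; apply: subset_trans Ss _; rewrite -[s]negbK -s1E.
by apply: side_nested; rewrite ?ep.
Qed.

Lemma inside_neq S e s : S \in faces -> e \in E ->
  (inside e S == s) = (S \subset side s e).
Proof.
move=> fS eE; apply/eqP/idP => [<-|]; first exact: face_side.
by apply: inside_side; rewrite ?ep ?face_card.
Qed.

Lemma chord_beyond e s : e \in inner_edges G ->
  exists z, [/\ z \in V, z \in side s e & z \notin e].
Proof.
rewrite inE => /andP[no eE]; have pe := ep eE.
have /subsetPn[z zV zs] : ~~ (V \subset side (~~ s) e).
  by apply: contra no => Vs; apply/outerP; split=> //; exists (~~ s).
exists z; split=> //; first by rewrite -[s]negbK; apply: sideU.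
by apply: contra zs; apply/subsetP; apply: sub_side.
Qed.

Lemma outer_not_sep e S S' : e \in outer_edges G -> S \in faces -> S' \in faces
  ->
  inside e S = inside e S'.
Proof.
move=> eo fS fS'; have eE := subsetP (outer_sub hG) _ eo.
have [_ [s Vs]] := outerP _ eo.
have h S0 : S0 \in faces -> inside e S0 = s.
  move=> f0; apply/eqP; rewrite inside_neq //.
  by apply: subset_trans (face_vertices f0) Vs.
by rewrite !h.
Qed.

(** A corner of [S'] outside [S] is beyond a side of [S]. If there is none, some corner of [S] is
    beyond a side of [S'], and then [S'], being part of [S], would lie on both sides of that
    edge. *)
Lemma face_sep S S' : S \in faces -> S' \in faces -> S != S' ->
  exists e, [/\ e \in inner_edges G, e \subset S & inside e S != inside e S'].
Proof.
move=> fS fS' ne.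
suff [e [eE eS ie]] : exists e, [/\ e \in E, e \subset S & inside e S != inside
  e S'].
  exists e; split=> //; rewrite inE eE andbT.
  by apply: contra ie => eo; rewrite (outer_not_sep eo fS fS').
have [sub|/subsetPn[z zS' zS]] := boolP (S' \subset S); last first.
  have zV := subsetP (face_vertices fS') _ zS'.
  have [s [e [eE eS Ss zs]]] := face_beyond fS zV zS.
  exists e; split=> //; have := Ss; rewrite -inside_neq // => /eqP ->.
  by rewrite eq_sym inside_neq //; apply: contra zs => /subsetP; apply.
have /subsetPn[z zS zS'] : ~~ (S \subset S').
  by apply: contra ne => sub'; rewrite eqEsubset sub sub'.
have zV := subsetP (face_vertices fS) _ zS.
have [s [e [eE eS Ss zs]]] := face_beyond fS' zV zS'.
have iS : inside e S != s.
  by rewrite inside_neq //; apply: contra zs => /subsetP; apply.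
case: (big_not_sub (ep eE) (face_card fS')).
apply: (sub_both_sides Ss); apply: subset_trans sub _.
by rewrite -inside_neq //; case: (inside e S) s iS {Ss zs} => [] [].
Qed.

(** A common edge lies on both sides of the separating chord from [face_sep], hence equals it. *)
Lemma share_inside S S' e : S \in faces -> S' \in faces -> S != S' ->
  e \in E -> e \subset S -> e \subset S' ->
  inside e S' = ~~ inside e S /\ e \in inner_edges G.
Proof.
move=> fS fS' ne eE eS eS'; have [f [fi fS0 ifn]] := face_sep fS fS' ne.
have fE : f \in E by move: fi; rewrite inE => /andP[].
suff -> : e = f by split=> //; case: (inside f S) (inside f S') ifn => [] [].
apply: (pair_inj (ep eE) (ep fE)).
apply: (@sub_both_sides _ G (inside f S)).
  exact: subset_trans eS (face_side fS fE).
apply: subset_trans eS' _; rewrite -inside_neq //.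
by case: (inside f S) (inside f S') ifn => [] [].
Qed.

(** This makes the number of separating edges behave as a distance in the dual tree. Nesting is
    applied to the face that is on the same side of [e] as [e']. *)
Lemma share_inside_other S S' e e' : S \in faces -> S' \in faces -> S != S' ->
  e \in E -> e \subset S -> e \subset S' -> e' \in E -> e' != e ->
  inside e' S' = inside e' S.
Proof.
move=> fS fS' ne eE eS eS' e'E ne';
  have [ie _] := share_inside fS fS' ne eE eS eS'.
have [s0 es0] := edge_side hG eE e'E.
have h S1 : S1 \in faces -> e \subset S1 -> s0 = inside e S1 ->
    side (~~ inside e S1) e \subset side (inside e' S1) e'.
  move=> f1 e1 s01; apply: side_nested; rewrite ?ep // 1?eq_sym // -?s01 //.
  exact: subset_trans e1 (face_side f1 e'E).
have [s0E|s0E] := eqVneq s0 (inside e S).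
  apply/eqP; rewrite inside_neq //; apply: subset_trans (h S fS eS s0E).
  by rewrite -ie; apply: face_side.
have {}s0E : s0 = inside e S' by rewrite ie;
  case: s0 (inside e S) s0E {es0 h ie} => [] [].
apply/esym/eqP; rewrite inside_neq //; apply: subset_trans (h S' fS' eS' s0E).
by rewrite ie negbK; apply: face_side.
Qed.

(** The face consists of the vertices on side [s] that no other edge hides from [e]. The extra
    vertex [z0] guarantees a third corner. *)
Lemma exists_face e s : e \in E -> (exists z, [/\ z \in V, z \in side s e & z
  \notin e]) ->
  exists S, [/\ S \in faces, e \subset S & S \subset side s e].
Proof.
move=> eE [z0 [z0V z0s z0e]].
pose near g s' := [&& g \in E, g != e & e \subset side s' g].
pose S := [set z in side s e | [forall g, forall s', near g s' ==> (z \in side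
  s' g)]].
have inS z : reflect (z \in side s e /\ forall g s', g \in E -> g != e ->
    e \subset side s' g -> z \in side s' g) (z \in S).
  rewrite [z \in S]in_set; apply: (iffP andP) => -[-> h]; split=> //.
    move=> g s' gE ge es; move/forallP/(_ g)/forallP/(_ s')/implyP: h; apply.
    by rewrite /near gE ge.
  apply/forallP => g; apply/forallP => s'; apply/implyP => /and3P[*].
  exact: h.
have eS : e \subset S.
  apply/subsetP => z ze; apply/inS; split;
    first exact: (subsetP (sub_side _ (ep eE))).
  by move=> g s' _ _ /subsetP; apply.
have Ss : S \subset side s e by apply/subsetP => z /inS[].
have beyond z : z \in side s e -> z \notin S -> exists g s',
    [/\ g \in E, g != e, g \subset S, e \subset side s' g & z \notin side s' g].
  move=> zs zS.
  pose P (gs : {set T} * bool) := near gs.1 gs.2 && (z \notin side gs.2 gs.1).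
  have [gs0 Pgs0] : exists gs, P gs.
    apply/existsP; apply: contraNT zS; rewrite negb_exists => /forallP nP.
    apply/inS; split=> // g s' gE ge es; have := nP (g, s').
    by rewrite /P /near gE ge es /= negbK.
  (* The edge hiding z from e that cuts off most vertices is a side of S. *)
  case: (arg_maxnP (fun gs => #|side (~~ gs.2) gs.1|) Pgs0) => -[g s'].
  case/andP=> /and3P[/= gE ge es] zs' gmax.
  exists g, s'; split=> //; apply/subsetP => x xg; apply/inS; split.
    have [s1 gs1] := edge_side hG eE gE.
    have [s1E|s1E] := eqVneq s1 s; first by rewrite -s1E; apply: (subsetP gs1).
    have {}s1E : s1 = ~~ s.
      by case: s1 s s1E {gs1 zs z0s Ss S inS eS P Pgs0 gmax near zS} => [] [].
    case/negP: zs'; apply: (subsetP (side_nested (ep eE) (ep gE) _ gs1 es)).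
      by rewrite eq_sym.
    by rewrite s1E negbK.
  move=> h s2 hE he es2; apply: contraT => xs2.
  have xh : x \in side (~~ s2) h.
    by apply: sideU xs2; case/andP: (ep gE) => _ /subsetP; apply.
  have xnh : x \notin h.
    by apply: contra xs2; apply/subsetP; apply: sub_side; apply: ep.
  have [s3 hg] := edge_side hG gE hE; have [s4 gh] := edge_side hG hE gE.
  have s4E : s4 = ~~ s2.
    by case: s4 s2 gh xs2 {es2 xh} => [] [] // /subsetP/(_ _ xg) ->.
  have gneh : g != h by apply: contraTneq xg => ->.
  have sub : side s2 h \subset side s3 g.
    rewrite -[s2]negbK -s4E; apply: side_nested; rewrite ?ep // 1?eq_sym //.
  have s3E : s3 = s'.
    apply: contraNeq ge => ne3; apply/eqP/esym/(pair_inj (ep eE) (ep gE)).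
    apply: (sub_both_sides es); apply: subset_trans (subset_trans es2 sub) _.
    by case: s3 s' ne3 {zs' hg sub es gmax} => [] [].
  rewrite s3E in hg sub.
  have far : side (~~ s') g \subset side (~~ s2) h.
    by apply: side_nested; rewrite ?ep // -s4E.
  have zh : z \notin side s2 h by apply: contra zs'; apply/subsetP.
  have := gmax (h, s2); rewrite /P /near /= hE he es2 zh => /(_ isT) le.
  have eqf : side (~~ s') g = side (~~ s2) h by apply/eqP; rewrite eqEcard far.
  case/negP: gneh; rewrite eq_sym; apply/eqP/(pair_inj (ep hE) (ep gE)).
  apply: (sub_both_sides hg); rewrite eqf; exact: sub_side (ep hE).
have SV : S \subset V := subset_trans Ss (side_vertices _ _ _).
exists S; split=> //; apply/faceP; split=> //.
  have sub3 z : z \in S -> z \notin e -> 2 < #|S|.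
    move=> zS ze; have /andP[/eqP <- _] := ep eE.
    by apply: proper_card; apply/properP; split=> //; exists z.
  have [z0S|z0S] := boolP (z0 \in S); first exact: sub3 z0S z0e.
  have [g [s' [gE ge gS _ _]]] := beyond _ z0s z0S.
  have /subsetPn[x xg xe] : ~~ (g \subset e).
    by apply: contra ge => ge; apply/eqP/(pair_inj (ep gE) (ep eE)).
  exact: sub3 (subsetP gS _ xg) xe.
move=> f pf fS; split=> [fE|[s' Sf]].
  have [->|fe] := eqVneq f e; first by exists s.
  have [s' es'] := edge_side hG fE eE; exists s'.
  by apply/subsetP => z /inS[_]; apply.
have [->//|fe] := eqVneq f e.
have fse : side (~~ s') f \subset side s e.
  exact: side_nested pf (ep eE) fe (subset_trans eS Sf) (subset_trans fS Ss).
(* Either nothing lies strictly beyond [f], which makes it an outer edge, or a vertex [z] there is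
   hidden from [e] by an edge [g] with both ends in [S], and nesting forces [f = g]. *)
have [/subsetPn[z zf' zf]|/negPn Vf] := boolP (~~ (side (~~ s') f \subset f));
  last first.
  apply: (subsetP (outer_sub hG)); apply/outerP; split=> //; exists s'.
  apply/subsetP => z zV; apply: contraT => zs.
  case/negP: (zs); apply: (subsetP (sub_side s' pf)); apply: (subsetP Vf).
  exact: sideU.
have zs' : z \notin side s' f by apply: contra zf => /sideI; apply.
have zs := subsetP fse _ zf'.
have zS : z \notin S by apply: contra zs'; apply/subsetP.
have [g [s2 [gE ge gS es2 zg]]] := beyond _ zs zS.
suff -> : f = g by [].
apply: contraNeq zs' => ne.
have fg : f \subset side s2 g.
  by apply/subsetP => x /(subsetP fS)/inS[_]; apply.
apply: (subsetP (side_nested (ep gE) pf _ fg (subset_trans gS Sf))).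
  by rewrite eq_sym.
by apply: sideU zg; apply: (subsetP (side_vertices _ _ _)) zs.
Qed.

Lemma neighbour S e : S \in faces -> e \in inner_edges G -> e \subset S ->
  exists S', [/\ S' \in faces, e \subset S' & inside e S' = ~~ inside e S].
Proof.
move=> fS ei eS; have eE : e \in E by move: ei; rewrite inE => /andP[].
have [S' [fS' eS' ss']] := exists_face eE (chord_beyond (~~ inside e S) ei).
by exists S'; split=> //; apply/eqP; rewrite inside_neq.
Qed.

End Faces.

(** * Connected sets of faces *)

Section Regions.
Variables (T : finType) (G : drawn_graph T).
Hypothesis hG : outerplanar G.
Implicit Types (e f g h S : {set T}) (x y z : T) (s : bool) (R : {set {set T}}).

Local Notation V := (vertices G).
Local Notation E := (edges G).
Local Notation side := (side G).
Local Notation inside := (inside G).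
Local Notation faces := (inner_faces G).
Local Notation pos := (position G).

Let Uc := circ_uniq hG.
Let ep := edge_pair hG.

(* Seen from a face outside R, all of R lies behind one and the same chord: R  *)
(* is a subtree of the dual tree.                                              *)
Definition gated R : Prop := [/\ R != set0, R \subset faces &
  forall f, f \in faces -> f \notin R -> exists e, [/\ e \in E, e \subset f &
    forall h, h \in R -> inside e h = ~~ inside e f]].

(** The closing side, from the first corner in list order to the last, is the only one with the
    polygon on side [true]. It is the reference edge in [boundary_parity]. *)
Lemma polygon_top S : S \subset V -> 1 < #|S| -> exists e,
  [/\ e \in cycle_edges (corners G S), S \subset side true e &
      forall e', pair G e' -> e' \subset S -> S \subset side true e' -> e' = e].
Proof.
move=> SV S2.
have [x xS] : exists x, x \in S by apply/set0Pn; rewrite -card_gt0; apply: ltnW.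
case: (@arg_minnP _ x (fun y => y \in S) pos xS) => a aS amin.
case: (@arg_maxnP _ x (fun y => y \in S) pos xS) => b bS bmax.
have aV := subsetP SV _ aS; have bV := subsetP SV _ bS.
have ab : pos a < pos b.
  rewrite ltnNge; apply/negP => ba; suff : #|S| <= #|[set a]|.
    by rewrite cards1 leqNgt S2.
  apply/subset_leq_card/subsetP => y yS;
    rewrite inE (pos_eq _ (subsetP SV _ yS)).
  by have := amin _ yS; have := bmax _ yS; clear -ba; lia.
have abS : S \subset side true [set a; b].
  apply/subsetP => y yS; rewrite in_side_set2 ?(subsetP SV) //.
  by have := amin _ yS; have := bmax _ yS; clear; lia.
exists [set a; b]; split=> //.
  apply/cycle_cornersP => //; split; last by exists true.
    by apply/pairP; exists a, b.
  by apply/subsetP => y; rewrite in_set2 => /orP[] /eqP ->.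
move=> e' /pairP[c [d [-> cV dV cd]]] cdS Scd.
have cS : c \in S by rewrite (subsetP cdS) ?set21.
have dS : d \in S by rewrite (subsetP cdS) ?set22.
have := subsetP Scd a aS; have := subsetP Scd b bS; rewrite !in_side_set2 //.
have := amin c cS; have := bmax d dS => h1 h2 h3 h4.
have -> : c = a.
  by apply/eqP; rewrite (pos_eq _ cV); clear -ab cd h1 h2 h3 h4; lia.
suff -> : d = b by [].
by apply/eqP; rewrite (pos_eq _ dV); clear -ab cd h1 h2 h3 h4; lia.
Qed.

Variable R : {set {set T}}.
Hypothesis gR : gated R.
Let W := cover R.
Let C := cycle_edges (corners G W).

Let RF f : f \in R -> f \in faces.
Proof. by case: gR => _ /subsetP sub _ /sub. Qed.

Lemma sub_cover f : f \in R -> f \subset W.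
Proof. exact: bigcup_sup. Qed.

Lemma cover_vertices : W \subset V.
Proof. by apply/bigcupsP => f /RF/face_vertices; apply. Qed.

Lemma cover_card : 2 < #|W|.
Proof.
case: gR => /set0Pn[f fR] _ _.
exact: leq_trans (face_card hG (RF fR)) (subset_leq_card (sub_cover fR)).
Qed.

Lemma cover_side s e : e \in E ->
  (W \subset side s e) <-> (forall f, f \in R -> inside e f = s).
Proof.
move=> eE; split=> [Ws f fR|h].
  by apply/eqP; rewrite inside_neq ?RF //;
    apply: subset_trans (sub_cover fR) Ws.
apply/bigcupsP => f fR; rewrite -(inside_neq hG) ?RF //; apply/eqP; exact: h.
Qed.

(** Among the faces [f] in [R] and sides [e] of [f] with [z] beyond them, take a pair with the
    smallest far side. The face [g] across [e] is not in [R], since it would offer a smaller pair.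
    The gate of [g] can only be [e], the one edge with [f] and [g] on different sides. *)
Lemma cover_beyond z : z \in V -> z \notin W -> exists f e,
  [/\ f \in R, e \in E, e \subset f, z \notin side (inside e f) e
    & forall h, h \in R -> inside e h = inside e f].
Proof.
move=> zV zW.
pose P (fe : {set T} * {set T}) := [&& fe.1 \in R, fe.2 \in E, fe.2 \subset fe.1
  & z \notin side (inside fe.2 fe.1) fe.2].
have beyond f : f \in R -> exists e, P (f, e).
  move=> fR; have zf : z \notin f.
    by apply: contra zW; apply/subsetP/sub_cover.
  have [s [e [eE ef fs zs]]] := face_beyond hG (RF fR) zV zf.
  by exists e; rewrite /P /= fR eE ef (inside_side (ep eE) (face_card hG (RF
    fR)) fs).
have [f0 f0R] : exists f, f \in R by apply/set0Pn; case: gR.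
have [e0 P0] := beyond _ f0R.
case: (arg_minnP (fun fe => #|side (~~ inside fe.2 fe.1) fe.2|) P0) => -[f e].
case/and4P => /= fR eE ef ze emin; exists f, e; split=> //.
have ze' := sideU zV ze.
have zne : z \notin e by apply: contra ze; apply/subsetP/sub_side/ep.
have [g [gF eg gs]] : exists g, [/\ g \in faces, e \subset g & g \subset side
  (~~ inside e f) e].
  by apply: (exists_face hG eE); exists z.
have gi : inside e g = ~~ inside e f by apply/eqP; rewrite inside_neq.
have fg : f != g by apply/eqP => fg; move: gi; rewrite fg; case: (inside e g).
have [gR'|gR'] := boolP (g \in R).
  have [e' /and4P[/= _ e'E e'g ze2]] := beyond _ gR'.
  have ee' : e != e' by apply: contra ze2 => /eqP <-; rewrite gi.
  have sub : side (~~ inside e' g) e' \subset side (inside e g) e.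
    apply: side_nested; rewrite ?ep // 1?eq_sym //.
      exact: subset_trans eg (face_side hG gF e'E).
    exact: subset_trans e'g (face_side hG gF eE).
  have := emin (g, e'); rewrite /P /= gR' e'E e'g ze2 -gi => /(_ isT) le.
  have eqs : side (~~ inside e' g) e' = side (inside e g) e.
    by apply/eqP; rewrite eqEcard sub.
  case/negP: ee'; apply/eqP/(pair_inj (ep eE) (ep e'E)).
  apply: (@sub_both_sides _ G (inside e' g)).
    exact: subset_trans eg (face_side hG gF e'E).
  by rewrite eqs; apply: sub_side; apply: ep.
case: gR => _ _ gate; have [e1 [e1E e1g h1]] := gate g gF gR'.
have e1e : e1 = e.
  have [//|ne] := eqVneq e1 e; have := h1 f fR.
  rewrite (share_inside_other hG (RF fR) gF fg eE ef eg e1E ne).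
  by case: (inside e1 f).
by move=> h hR; rewrite -e1e h1 // e1e gi negbK.
Qed.

(** A side of the hull of the covered vertices is an outer edge if no vertex is beyond it; otherwise
    nesting identifies it with the edge from [cover_beyond]. The face at that side, on the side of
    the hull, belongs to [R], for otherwise its gate would be the same edge. *)
Lemma boundaryP e : reflect (e \in E /\ exists f, [/\ f \in R, e \subset f
  & forall h, h \in R -> inside e h = inside e f]) (e \in C).
Proof.
have cP := @cycle_cornersP _ _ Uc W e cover_vertices (ltnW cover_card).
apply: (iffP cP) => [[pe eW [s Ws]]|[eE [f [fR ef hf]]]]; last first.
  split; first exact: ep.
    exact: subset_trans ef (sub_cover fR).
  by exists (inside e f); apply/cover_side.
have eE : e \in E.
  have [/subsetPn[z zV zs]|/negPn Vs] := boolP (~~ (V \subset side s e));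
    last first.
    by apply: (subsetP (outer_sub hG)); apply/(outerP hG); split=> //; exists s.
  have zW : z \notin W by apply: contra zs; apply/subsetP.
  have [f [e' [fR e'E e'f ze' he']]] := cover_beyond zV zW.
  have [<-//|ne] := eqVneq e' e.
  have eW' : e \subset side (inside e' f) e'.
    by apply: subset_trans eW _; apply/cover_side.
  have e'W : e' \subset side s e.
    by apply: subset_trans Ws; apply: subset_trans e'f (sub_cover fR).
  have := subsetP (side_nested (ep e'E) pe ne eW' e'W) z (sideU zV ze').
  by rewrite (negbTE zs).
split=> //.
have [z zW ze] : exists2 z, z \in W & z \notin e.
  by apply/subsetPn/negP; exact: (big_not_sub pe cover_card).
have [f [fF ef fs]] : exists f, [/\ f \in faces, e \subset f & f \subset side s
  e].
  apply: (exists_face hG eE); exists z.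
  by rewrite ze (subsetP Ws) // (subsetP cover_vertices).
have fi : inside e f = s by apply/eqP; rewrite inside_neq.
exists f; rewrite fi; have he := (cover_side s eE).1 Ws; split=> //.
apply: contraT => fR; case: gR => _ _ /(_ f fF fR)[e1 [e1E e1f h1]].
have W1 : W \subset side (~~ inside e1 f) e1 by apply/cover_side.
have ee1 : e = e1.
  apply: (pair_inj pe (ep e1E)); apply: (@sub_both_sides _ G (inside e1 f)).
    exact: subset_trans ef (face_side hG fF e1E).
  exact: subset_trans eW W1.
case: (big_not_sub pe cover_card); apply: sub_both_sides Ws _.
by rewrite -fi ee1.
Qed.

(** The parity is the colour that [C] itself induces, so flipping [C] inverts the colours exactly on
    [R]. A face of [R] is inside the closing side [t] only; a face outside [R] lies beyond exactly
    one boundary edge, which changes the count by one. *)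
Lemma boundary_parity f : f \in faces ->
  odd #|[set e in C | inside e f]| = (f \in R).
Proof.
move=> fF; have [t [tC Wt tu]] := polygon_top cover_vertices (ltnW cover_card).
have [tE _] := boundaryP _ tC.
have ti h : h \in R -> inside t h by move=> hR;
  apply: ((cover_side true tE).1 Wt).
have uniq_t e : e \in C -> W \subset side true e -> e = t.
  move=> eC We; apply: tu => //; first by have [/ep] := boundaryP _ eC.
  by have [_ [g [gR' eg _]]] := boundaryP _ eC;
    apply: subset_trans eg (sub_cover gR').
have [fR|fR] := boolP (f \in R).
  suff -> : [set e in C | inside e f] = [set t] by rewrite cards1.
  apply/setP => e; rewrite !inE; apply/andP/eqP => [[eC ief]|->];
    last by rewrite ti.
  apply: uniq_t => //; have [eE [g [_ _ hg]]] := boundaryP _ eC.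
  by apply/cover_side => // h hR; rewrite hg // -(hg f).
case: (gR) => _ _ /(_ f fF fR)[e1 [e1E e1f h1]].
have [z zf ze1] : exists2 z, z \in f & z \notin e1.
  by apply/subsetPn/negP; exact: (big_not_sub (ep e1E) (face_card hG fF)).
have zV := subsetP (face_vertices hG fF) _ zf.
have zW : z \notin W.
  apply: contra ze1 => zW; apply: (@sideI _ G (inside e1 f)).
    exact: subsetP (face_side hG fF e1E) _ zf.
  by apply: subsetP zW; apply/cover_side.
have [g [e [gR' eE eg ze he]]] := cover_beyond zV zW.
have eC : e \in C by apply/boundaryP; split=> //; exists g.
have ief : inside e f = ~~ inside e g.
  have := face_side hG fF eE; case: (inside e f) (inside e g) ze => [] [] // ze;
  by move=> /subsetP/(_ _ zf); rewrite (negbTE ze).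
have other e' : e' \in C -> e' != e -> inside e' f = inside e' g.
  move=> e'C ne; have [e'E [g' [g'R e'g' hg']]] := boundaryP _ e'C.
  apply/eqP; rewrite inside_neq // hg' //.
  have fs := face_side hG fF eE; rewrite ief in fs.
  apply: subset_trans fs _; apply: side_nested; rewrite ?ep // 1?eq_sym //.
    rewrite -(he g') //; apply: subset_trans e'g' _;
      exact: face_side (RF g'R) eE.
  by rewrite -(hg' g) //; apply: subset_trans eg _;
    exact: face_side (RF gR') e'E.
have inner e' : e' \in C -> inside e' g = (e' == t).
  move=> e'C; have [e'E [g' [g'R _ hg']]] := boundaryP _ e'C.
  apply/idP/eqP => [ig|->]; last exact: ti.
  by apply: uniq_t => //; apply/cover_side => // h hR; rewrite hg' // -(hg' g).
have [et|et] := eqVneq e t.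
  rewrite (_ : [set _ in _ | _] = set0) ?cards0 //.
  apply/setP => e'; rewrite !inE; apply/negbTE; rewrite negb_and.
  have [e'C|//] := boolP (e' \in C); have [->|ne] := eqVneq e' e.
    by rewrite ief et (ti g).
  by rewrite (other _ e'C ne) inner // -et ne.
rewrite (_ : [set _ in _ | _] = [set e; t]) ?cards2 ?et //.
apply/setP => e'; rewrite !inE; have [->|ne] := eqVneq e' e.
  by rewrite eC ief inner // et.
have [e'C|e'C] := boolP (e' \in C); first by rewrite (other _ e'C ne) inner.
by rewrite /=; apply/esym/negbTE; apply: contra e'C => /eqP ->.
Qed.

End Regions.

(** * Alternating cycles and perfect matchings *)

Section Cycles.
Variable T : finType.
Implicit Types (p q : seq T) (x y z : T) (e C M : {set {set T}}).

Lemma cycle_rot p x : uniq p -> 2 < size p -> x \in p -> exists y q z i,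
  [/\ rot i p = x :: y :: rcons q z, next p x = y & prev p x = z].
Proof.
move=> Up sp xp; case: (rot_to xp) => i p' rp.
have Ur : uniq (x :: p') by rewrite -rp rot_uniq.
have sr : size (x :: p') = size p by rewrite -rp size_rot.
case: p' rp Ur sr => [|y p''] rp Ur /= sr; first by move: sp; rewrite -sr.
case/lastP: p'' rp Ur sr => [|q z] rp Ur sr; first by move: sp; rewrite -sr.
exists y, q, z, i; split=> //.
  by rewrite -(next_rot i) // rp /= eqxx.
rewrite -(prev_rot i) // rp prev_nth mem_head.
case/andP: Ur => /memPn xn _.
have /memNindex -> : x \notin y :: rcons q z by apply/negP => /xn; rewrite eqxx.
by rewrite -[nth _ _ _]/(nth x (y :: rcons q z) (size (rcons q z))) -[size
  _]/((size (y :: rcons q z)).-1) nth_last /= last_rcons.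
Qed.

Lemma next_neq_prev p x : uniq p -> 2 < size p -> x \in p ->
  [/\ next p x != x, prev p x != x & next p x != prev p x].
Proof.
move=> Up sp xp; have [y [q [z [i [rp -> ->]]]]] := cycle_rot Up sp xp.
have : uniq (x :: y :: rcons q z) by rewrite -rp rot_uniq.
rewrite /= !inE !mem_rcons !inE !negb_or.
case/andP=> /and3P[xy xz _] /andP[/andP[yz _] _].
by rewrite ![_ == x]eq_sym.
Qed.

Lemma next_edge p x : x \in p -> [set x; next p x] \in cycle_edges p.
Proof. by move=> xp; apply/imsetP; exists x. Qed.

Lemma prev_edge p x : uniq p -> x \in p -> [set prev p x; x] \in cycle_edges p.
Proof.
move=> Up xp; apply/imsetP; exists (prev p x); rewrite ?mem_prev //.
by rewrite next_prev.
Qed.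

Lemma cycle_edges_inc p (e : {set T}) x : uniq p -> e \in cycle_edges p -> x
  \in e ->
  x \in p /\ (e = [set x; next p x] \/ e = [set prev p x; x]).
Proof.
move=> Up /imsetP[y yp ->]; rewrite in_set2 => /orP[] /eqP ->.
  by split=> //; left.
by rewrite mem_next prev_next //; split=> //; right.
Qed.

Lemma cycle_edges_rot p i : uniq p -> cycle_edges (rot i p) = cycle_edges p.
Proof.
move=> Up; apply/setP => e; apply/imsetP/imsetP => -[x xp ->]; exists x => //.
- by rewrite -(mem_rot i).
- by rewrite next_rot.
- by rewrite mem_rot.
- by rewrite next_rot.
Qed.

Lemma cycle_edges_path x q : uniq (x :: q) ->
  path (fun u v => [set u; v] \in cycle_edges (x :: q)) x q.
Proof.
move=> Uq; have := cycle_next Uq; rewrite /= rcons_path => /andP[pq _].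
apply: (@sub_in_path _ (mem (x :: q)) (frel (next (x :: q)))) => //;
  last exact/allP.
by move=> u v ux _ /eqP <-; apply: next_edge.
Qed.

End Cycles.

(** * Perfect matchings and the effect of a flip *)

Section Matchings.
Variables (T : finType) (G : drawn_graph T).
Implicit Types (e g : {set T}) (M N C : {set {set T}}) (x y : T).

Lemma perfect_edge M x : perfect_matching G M -> x \in vertices G ->
  exists g, [/\ g \in M, x \in g & forall h, h \in M -> x \in h -> h = g].
Proof.
case=> _ /(_ x) h /h /eqP/cards1P[g /setP gP]; exists g.
have := gP g; rewrite !inE eqxx => /andP[gM xg]; split=> // k kM xk.
by have := gP k; rewrite !inE kM xk => /esym/eqP.
Qed.

Lemma perfect_matchingP M : M \subset edges G ->
  (forall x, x \in vertices G ->
    exists g, [/\ g \in M, x \in g & forall h, h \in M -> x \in h -> h = g]) ->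
  perfect_matching G M.
Proof.
move=> ME h; split=> // x xV; have [g [gM xg gu]] := h x xV.
apply/eqP/cards1P; exists g; apply/setP => k; rewrite !inE.
by apply/andP/eqP => [[kM xk]|->//]; apply: gu.
Qed.

Lemma in_symdiff (A B : {set {set T}}) e :
  (e \in symdiff A B) = (e \in A) (+) (e \in B).
Proof. by rewrite !inE; case: (e \in A); case: (e \in B). Qed.

Lemma symdiff_symdiff (A B : {set {set T}}) : symdiff A (symdiff A B) = B.
Proof. by apply/setP => e; rewrite !in_symdiff addbA addbb. Qed.

Lemma alternating_perfect M C : perfect_matching G M -> alternating_cycle G M C
  ->
  perfect_matching G (symdiff M C).
Proof.
move=> pM [p [Up sp -> CE alt]]; case: (pM) => ME _.
apply: perfect_matchingP.
  apply/subsetP => e; rewrite in_symdiff.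
  by have [/(subsetP ME)//|_ /(subsetP CE)] := boolP (e \in M).
move=> x xV; have [g [gM xg gu]] := perfect_edge pM xV.
have [xp|xp] := boolP (x \in p); last first.
  have xC (h : {set T}) : x \in h -> h \notin cycle_edges p.
    by move=> xh; apply: contra xp => hC; have [] := cycle_edges_inc Up hC xh.
  exists g; rewrite in_symdiff gM (negbTE (xC _ xg)); split=> // h.
  by rewrite in_symdiff => + xh; rewrite (negbTE (xC _ xh)) addbF => /gu; apply.
have := alt x xp; set a := [set x; _]; set b := [set _; x] => ab.
have aC : a \in cycle_edges p by apply: next_edge.
have bC : b \in cycle_edges p by apply: prev_edge.
have xa : x \in a by rewrite set21.
have xb : x \in b by rewrite set22.
(* [c] is the cycle edge at [x] outside [M]; it becomes the matching edge of [x]. *)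
pose c := if a \in M then b else a.
have [cM cC xc] : [/\ c \notin M, c \in cycle_edges p & x \in c].
  rewrite /c; case: (boolP (a \in M)) => aM; split=> //.
  by rewrite -ab.
exists c; rewrite in_symdiff (negbTE cM) cC; split=> // h.
rewrite in_symdiff => hMC xh.
have abC : h \in cycle_edges p -> h = a \/ h = b.
  by move=> hC; have [] := cycle_edges_inc Up hC xh.
have [hM|hM] := boolP (h \in M).
  move: hMC; rewrite hM /= => /negP[].
  rewrite (gu _ hM xh); have [aM|aM] := boolP (a \in M).
    by rewrite -(gu _ aM xa).
  have bM : b \in M by apply: contraNT aM; rewrite ab.
  by rewrite -(gu _ bM xb).
move: hMC; rewrite (negbTE hM) => /abC; rewrite /c.
case=> hE; first by rewrite -hE (negbTE hM).
by rewrite ab -hE hM.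
Qed.

End Matchings.

(** * The colouring of the faces by a perfect matching *)

Lemma odd_sum (I : finType) (A : {set I}) (F : I -> nat) :
  odd (\sum_(i in A) F i) = odd #|[set i in A | odd (F i)]|.
Proof.
have -> : #|[set i in A | odd (F i)]| = \sum_(i in A | odd (F i)) 1.
  by rewrite -sum1_card; apply: eq_bigl => i; rewrite inE.
rewrite [in RHS]big_mkcondr /= !(big_morph odd oddD (erefl : odd 0 = false)).
by apply: eq_bigr => i _; case: (odd _).
Qed.

Lemma odd_card_symdiff (I : finType) (A B : {set I}) :
  odd #|[set i | (i \in A) (+) (i \in B)]| = odd #|A| (+) odd #|B|.
Proof.
rewrite -(cardsID B A) -(cardsID A B) !oddD (setIC B A).
rewrite addbACA addbb /= -oddD; congr odd.
rewrite -(cardsID A); congr (_ + _); apply: eq_card => i; rewrite !inE.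
  by case: (i \in A); case: (i \in B).
by case: (i \in A); case: (i \in B).
Qed.

Lemma cardsI_sum (I : finType) (A B : {set I}) :
  #|A :&: B| = \sum_(i in B) (i \in A).
Proof.
transitivity (\sum_(i in B | i \in A) 1).
  by rewrite -sum1_card; apply: eq_bigl => i; rewrite inE andbC.
by rewrite big_mkcondr; apply: eq_bigr => i _; case: (i \in A).
Qed.

Section Colours.
Variables (T : finType) (G : drawn_graph T).
Hypothesis hG : outerplanar G.
Implicit Types (e f g h S : {set T}) (x y z : T) (s : bool) (R M N : {set {set
  T}}).

Local Notation V := (vertices G).
Local Notation E := (edges G).
Local Notation side := (side G).
Local Notation inside := (inside G).
Local Notation faces := (inner_faces G).
Local Notation pos := (position G).

Let Uc := circ_uniq hG.
Let ep := edge_pair hG.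

Definition colour M f : bool := odd #|[set e in M | inside e f]|.

Lemma colour_symdiff M N f : colour (symdiff M N) f = colour M f (+) colour N f.
Proof.
rewrite /colour -odd_card_symdiff; congr odd; apply: eq_card => e.
rewrite [LHS]inE in_symdiff !inE.
by case: (e \in M); case: (e \in N); case: (inside e f).
Qed.

Lemma colour_diff M f f' : colour M f (+) colour M f' =
  odd #|[set e in M | inside e f != inside e f']|.
Proof.
rewrite /colour -odd_card_symdiff; congr odd; apply: eq_card => e; rewrite !inE.
by case: (e \in M); case: (inside e f); case: (inside e f').
Qed.

Lemma colour_share M f f' e : M \subset E -> f \in faces -> f' \in faces ->
  f != f' -> e \in E -> e \subset f -> e \subset f' ->
  colour M f' = colour M f (+) (e \in M).
Proof.
move=> ME fF f'F ne eE ef ef'.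
have [ie _] := share_inside hG fF f'F ne eE ef ef'.
suff <- : colour M f (+) colour M f' = (e \in M) by rewrite addKb.
rewrite colour_diff; set A := [set _ in _ | _].
have AE : A = if e \in M then [set e] else set0.
  apply/setP => e'; rewrite inE; have [->|ne'] := eqVneq e' e.
    by rewrite ie; case: (e \in M); case: (inside e f); rewrite !inE ?eqxx.
  have [e'M|e'M] := boolP (e' \in M).
    rewrite (share_inside_other hG fF f'F ne eE ef ef' _ ne') ?(subsetP ME) //.
    by rewrite eqxx; case: (e \in M); rewrite !inE // (negbTE ne').
  by case: (e \in M); rewrite !inE // (negbTE ne').
by rewrite AE; case: (e \in M); rewrite ?cards1 ?cards0.
Qed.

Lemma card_below x : x \in V -> #|[set z in V | pos z < pos x]| = pos x.
Proof.
rewrite inE => xV; have le : pos x <= size (circ G) by apply: index_size.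
rewrite -[RHS](size_takel le) -(card_uniqP (take_uniq (pos x) Uc)).
apply: eq_card => z; rewrite !inE.
have [zV|zV] := boolP (z \in circ G); first by rewrite in_take.
by apply/esym/negbTE; apply: contra zV; apply: mem_take.
Qed.

(** Count the [pos x] vertices before [x] through their matching edges: an edge has exactly one end
    among them when it spans [x], and the edge at [x] itself contributes if its other end [y] comes
    first. *)
Lemma odd_card_below M g x y : perfect_matching G M -> g \in M -> g = [set x;
  y] ->
  x != y ->
  odd #|[set e in M | between G e x]| = odd (pos x) (+) (pos y < pos x).
Proof.
move=> pM gM gxy xy; case: (pM) => ME _.
have pg := ep (subsetP ME _ gM).
have gV : g \subset V by case/andP: pg.
have xg : x \in g by rewrite gxy set21.
have xV : x \in V := subsetP gV _ xg.
have yV : y \in V by apply: (subsetP gV); rewrite gxy set22.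
have [g' [_ _ gu]] := perfect_edge pM xV.
have {}gu h : h \in M -> x \in h -> h = g.
  by move=> hM xh; rewrite (gu h) // (gu g).
set L := [set z in V | pos z < pos x].
have pxL : odd (pos x) = odd #|[set e in M | odd #|e :&: L|]|.
  rewrite -odd_sum -[in LHS](card_below xV) -/L; congr odd.
  transitivity (\sum_(z in L) \sum_(e in M) (z \in e : nat)).
    rewrite -sum1_card; apply: eq_bigr => z; rewrite inE => /andP[zV _].
    have [_ /(_ z zV) <-] := pM;
      rewrite (_ : [set _ in _ | _] = [set e : {set T} | z \in e] :&: M).
      by rewrite cardsI_sum; apply: eq_bigr => e _; rewrite inE.
    by apply/setP => e; rewrite !inE andbC.
  by rewrite exchange_big; apply: eq_bigr => e _; rewrite cardsI_sum.
have oddL e : e \in M -> odd #|e :&: L| = between G e x (+) ((e == g) && (pos y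
  < pos x)).
  move=> eM; have /pairP[a [b [eab aV bV ab]]] := ep (subsetP ME _ eM).
  have -> : #|e :&: L| = (pos a < pos x) + (pos b < pos x).
    have nab : a != b by rewrite (pos_eq _ aV) neq_ltn ab.
    rewrite setIC cardsI_sum eab big_setU1 ?inE // big_set1 /= !inE.
    rewrite !inE in aV bV; rewrite aV bV /=.
    by case: (_ < _); case: (_ < _).
  have [xe|xe] := boolP (x \in e).
    have eg := gu e eM xe; rewrite eg eqxx /= -eg eab between_set2 //.
    move: xe; rewrite eab in_set2 => /orP[] /eqP xE.
      have yb : y = b.
        have : b \in [set x; y] by rewrite -gxy -eg eab set22.
        by rewrite in_set2 xE => /orP[] /eqP // ba; rewrite ba ltnn in ab.
      by rewrite yb xE; clear -ab; lia.
    have ya : y = a.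
      have : a \in [set x; y] by rewrite -gxy -eg eab set21.
      by rewrite in_set2 xE => /orP[] /eqP // ba; rewrite ba ltnn in ab.
    by rewrite ya xE; clear -ab; lia.
  have -> : (e == g) = false by apply: contraNF xe => /eqP ->.
  rewrite eab between_set2 //= addbF.
  have : (pos x != pos a) && (pos x != pos b).
    move: xe; rewrite eab in_set2 negb_or (pos_eq _ xV).
    by rewrite (pos_eq _ xV).
  by clear -ab; lia.
rewrite pxL; set y_below := pos y < pos x in oddL *.
rewrite -[y_below](_ : odd #|[set e in M | (e == g) && y_below]| = _);
  last first.
  case: y_below {oddL} => /=;
    last by rewrite (_ : [set _ in _ | _] = set0) ?cards0 //;
    apply/setP => e; rewrite !inE andbF andbF.
  rewrite (_ : [set _ in _ | _] = [set g]) ?cards1 //.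
  by apply/setP => e; rewrite !inE andbT; case: eqP => [->|];
    rewrite ?gM ?andbF.
rewrite -odd_card_symdiff; congr odd; apply: eq_card => e; rewrite !inE.
have [eM|//] := boolP (e \in M); rewrite oddL // /=.
by case: (between _ _ _); case: (_ && _).
Qed.

(** A matching edge that misses the corner [x] has [f] inside iff it spans [x], so [odd_card_below]
    evaluates all edges but the one at [x]. The colour therefore depends on [M] only through the
    partner of [x]. *)
Lemma colour_corner M f x y : perfect_matching G M -> f \in faces -> x \in f ->
  x != y -> [set x; y] \in M ->
  colour M f = odd (pos x) (+) (pos y < pos x) (+) inside [set x; y] f.
Proof.
move=> pM fF xf xy; set g := [set x; y] => gM; case: (pM) => ME _.
rewrite -(odd_card_below pM gM (erefl _) xy).
have xV := subsetP (face_vertices hG fF) _ xf.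
have [g' [_ _ gu]] := perfect_edge pM xV.
have xg : x \in g by rewrite set21.
have {}gu h : h \in M -> x \in h -> h = g.
  by move=> hM xh; rewrite (gu h) // (gu g).
rewrite -[inside g f](_ : odd #|[set e in M | (e == g) && inside g f]| = _);
  last first.
  case: (inside g f); last by rewrite (_ : [set _ in _ | _] = set0) ?cards0 //;
    apply/setP => e; rewrite !inE !andbF.
  rewrite (_ : [set _ in _ | _] = [set g]) ?cards1 //.
  by apply/setP => e; rewrite !inE andbT; case: eqP => [->|];
    rewrite ?gM ?andbF.
rewrite -odd_card_symdiff; congr odd; apply: eq_card => e; rewrite !inE.
have [eM|//] := boolP (e \in M); rewrite /=.
have eE := subsetP ME _ eM.
have [xe|xe] := boolP (x \in e).
  rewrite (gu e eM xe) eqxx /=.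
  have -> : between G g x = false.
    have /pairP[a [b [gab aV bV ab]]] := ep (subsetP ME _ gM).
    rewrite gab between_set2 //.
    by move: xg; rewrite gab in_set2 => /orP[] /eqP ->; rewrite ltnn ?andbF.
  by [].
have -> : (e == g) = false by apply: contraNF xe => /eqP ->.
rewrite addbF; have := subsetP (face_side hG fF eE) _ xf.
by rewrite [x \in _]inE xV (negbTE xe) /= => /eqP ->.
Qed.

(** The value is the opposite of what [colour_corner] gives for a perfect matching containing [e].
    The proof compares the circular orders of [x], [b] and the partner [y] of [x]. *)
Lemma colour_corner_beyond M f e g x b : perfect_matching G M -> f \in faces ->
  e \in E -> e \subset f -> e = [set x; b] -> x != b ->
  g \in M -> x \in g -> g != e -> g \subset side (inside e f) e ->
  colour M f = ~~ (odd (pos x) (+) (pos b < pos x) (+) inside e f).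
Proof.
move=> pM fF eE ef exb xb gM xg ge gs; case: (pM) => ME _.
have gE := subsetP ME _ gM.
have [y gxy xy] : exists2 y, g = [set x; y] & x != y.
  have /andP[/cards2P[c [d [cd gcd]]] _] := ep gE.
  move: xg; rewrite gcd in_set2 => /orP[] /eqP ->; first by exists d.
  by exists c; rewrite 1?setUC // eq_sym.
have xf : x \in f by apply: (subsetP ef); rewrite exb set21.
have bf : b \in f by apply: (subsetP ef); rewrite exb set22.
rewrite (colour_corner pM fF xf xy); last by rewrite -gxy.
have xV := subsetP (face_vertices hG fF) _ xf.
have bV := subsetP (face_vertices hG fF) _ bf.
have yg : y \in g by rewrite gxy set22.
have yV : y \in V by case/andP: (ep gE) => _ /subsetP; apply.
have by' : b != y by apply: contraNneq ge => byE; rewrite gxy exb byE.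
have := subsetP gs y yg; have := subsetP (face_side hG fF gE) b bf.
rewrite -gxy; move: (inside e f) (inside g f) => s1 s2.
have nat_side u v w s : u \in V -> v \in V -> w \in V -> u != v -> u != w -> v
  != w ->
    w \in side s [set u; v] ->
    ((pos u < pos w < pos v) || (pos v < pos w < pos u)) = s.
  move=> uV vV wV; rewrite (pos_eq _ uV) => uv uw vw.
  have [lt|gt|eq] := ltngtP (pos u) (pos v).
  - rewrite in_side_set2 //; move: uw vw; rewrite (pos_eq _ uV) (pos_eq _ vV).
    by clear -lt; case: s; lia.
  - rewrite setUC in_side_set2 //; move: uw vw;
    rewrite (pos_eq _ uV) (pos_eq _ vV).
    by clear -gt; case: s; lia.
  - by move: uv; rewrite eq eqxx.
rewrite {1}gxy exb => h1 h2.
have := nat_side x y b s2 xV yV bV xy xb _ h1; rewrite eq_sym => /(_ by').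
have := nat_side x b y s1 xV bV yV xb xy by' h2.
move: xy xb by'; rewrite !(pos_eq _ xV) (pos_eq _ bV).
by clear; case: s1; case: s2; case: (odd _); lia.
Qed.

Lemma edge_face e : e \in E -> exists2 f, f \in faces & e \subset f.
Proof.
move=> eE; have pe := ep eE.
have [z zV ze] : exists2 z, z \in V & z \notin e.
  apply/subsetPn/negP; apply: (big_not_sub pe).
  by rewrite -(size_corners Uc (subxx V)) cornersT (circ_size hG).
have [zs|zs] := boolP (z \in side true e).
  by have [|f []] := exists_face hG (s := true) eE; [exists z | exists f].
have [|f []] := exists_face hG (s := false) eE; last by exists f.
by exists z; split=> //; apply: sideU zs.
Qed.

Lemma outer_side e f : e \in outer_edges G -> f \in faces -> e \subset f ->
  V \subset side (inside e f) e.
Proof.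
move=> eo fF ef; have [pe [s Vs]] := outerP hG _ eo.
have eE := subsetP (outer_sub hG) _ eo.
suff -> : inside e f = s by [].
by apply/eqP; rewrite inside_neq //;
  apply: subset_trans (face_vertices hG fF) Vs.
Qed.

(** All vertices are on the same side of an outer edge as its face, so one of [colour_corner] and
    [colour_corner_beyond] applies to each matching. Hence the outer edges of a face are all in the
    symmetric difference or all outside it. *)
Lemma colour_outer M N f e : perfect_matching G M -> perfect_matching G N ->
  f \in faces -> e \in outer_edges G -> e \subset f ->
  (colour M f == colour N f) = ((e \in M) == (e \in N)).
Proof.
move=> pM pN fF eo ef; have eE := subsetP (outer_sub hG) _ eo.
have /andP[/cards2P[x [b [xb exb]]] eV] := ep eE.
have Vs := outer_side eo fF ef.
have xe : x \in e by rewrite exb set21.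
have xV := subsetP eV _ xe.
have key P : perfect_matching G P ->
    colour P f = odd (pos x) (+) (pos b < pos x) (+) inside e f (+) (e \notin
      P).
  move=> pP; have [eP|eP] := boolP (e \in P).
    rewrite addbF exb; apply: colour_corner => //; rewrite -?exb //.
    exact: (subsetP ef).
  have [g [gP xg _]] := perfect_edge pP xV; rewrite addbT.
  apply: (colour_corner_beyond pP fF eE ef exb xb gP xg).
    by apply: contraNneq eP => <-.
  apply: subset_trans Vs; case: pP => PE _.
  by case/andP: (ep (subsetP PE _ gP)).
rewrite !key //; case: (e \in M); case: (e \in N); case: (odd _); case: (_ < _);
by case: (inside e f).
Qed.

Lemma eq_colour M N : perfect_matching G M -> perfect_matching G N ->
  (forall f, f \in faces -> colour M f = colour N f) -> M = N.
Proof.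
move=> pM pN eqc; case: (pM) => ME _; case: (pN) => NE _.
have key e : e \in E -> (e \in M) = (e \in N).
  move=> eE; have [f fF ef] := edge_face eE.
  have [eo|eo] := boolP (e \in outer_edges G).
    by apply/eqP; rewrite -(colour_outer pM pN fF eo ef) eqc.
  have [|f' [f'F ef' ie]] := neighbour hG fF _ ef; first by rewrite inE eo.
  have ne : f != f' by apply/eqP => eqf; move: ie; rewrite eqf;
    case: (inside e f').
  have := colour_share ME fF f'F ne eE ef ef'.
  rewrite !eqc // (colour_share NE fF f'F ne eE ef ef').
  by case: (colour N f); case: (e \in M); case: (e \in N).
apply/setP => e; have [/key //|eE] := boolP (e \in E).
rewrite (contraNF (subsetP ME e) eE).
by rewrite (contraNF (subsetP NE e) eE).
Qed.

(** It suffices that every matching edge at a covered vertex is a boundary edge ([inC]). One with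
    both ends covered that is not on the boundary would separate two faces of [R] of distinct
    colours. One leaving the hull passes beyond an unmatched boundary edge [e]; by
    [colour_corner_beyond] the face across [e] then has a colour that no perfect matching containing
    [e] gives it, against the last hypothesis. *)
Lemma flip_region M R : perfect_matching G M -> gated G R ->
  (forall f f', f \in R -> f' \in R -> colour M f = colour M f') ->
  (forall e f g, e \in cycle_edges (corners G (cover R)) -> e \notin M ->
     f \in R -> e \subset f -> g \in faces -> g \notin R -> e \subset g ->
     exists N, [/\ perfect_matching G N, e \in N & colour M g = colour N g]) ->
  let C := cycle_edges (corners G (cover R)) in
  [/\ alternating_cycle G M C, perfect_matching G (symdiff M C) &
      forall f, f \in faces -> colour (symdiff M C) f = colour M f (+) (f \in
        R)].
Proof.
move=> pM gR mono cut C; case: (pM) => ME _; case: (gR) => _ /subsetP RF gate.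
have WV := cover_vertices hG gR; have W3 := cover_card hG gR.
have bP := boundaryP hG gR.
have inC g x : g \in M -> x \in g -> x \in cover R -> g \in C.
  move=> gM xg xW; have gE := subsetP ME _ gM.
  have [gW|/subsetPn[z zg zW]] := boolP (g \subset cover R).
    apply: contraT => gC.
    have notside s : ~ cover R \subset side s g.
      move=> Ws; case/negP: gC; apply/cycle_cornersP; rewrite ?ep //;
        first exact: ltnW.
      by split; rewrite ?ep //; exists s.
    have gi : g \in inner_edges G.
      rewrite inE gE andbT; apply/negP => /(outerP hG)[_ [s Vs]].
      by apply: (notside s); apply: subset_trans WV Vs.
    have inR s : exists f, [/\ f \in R, g \subset f & inside g f = s].
      have [f [fF gf fs]] := exists_face hG gE (chord_beyond hG s gi).
      have fi : inside g f = s by apply/eqP; rewrite inside_neq.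
      exists f; split=> //; apply: contraT => fR;
        have [e [eE ef he]] := gate f fF fR.
      have We : cover R \subset side (~~ inside e f) e by apply/(cover_side hG
        gR).
      have ge : g = e.
        apply: (pair_inj (ep gE) (ep eE));
          apply: (@sub_both_sides _ G (inside e f)).
          exact: subset_trans gf (face_side hG fF eE).
        exact: subset_trans gW We.
      by case: (notside (~~ inside e f)); rewrite ge.
    have [f [fR gf fi]] := inR true; have [f' [f'R gf' f'i]] := inR false.
    have ne : f != f' by apply/eqP => eqf; rewrite eqf f'i in fi.
    have := colour_share ME (RF _ fR) (RF _ f'R) ne gE gf gf'.
    by rewrite gM (mono f f') //; case: (colour M f').
  have gV : g \subset V by case/andP: (ep gE).
  have zV := subsetP gV _ zg.
  have [f [e [fR eE ef ze he]]] := cover_beyond hG gR zV zW.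
  have We : cover R \subset side (inside e f) e by apply/(cover_side hG gR).
  have eC : e \in C by apply/bP; split=> //; exists f.
  have gs : g \subset side (~~ inside e f) e.
    have [s gs] := edge_side hG eE gE.
    have : s != inside e f by apply: contraNneq ze => <-; apply: (subsetP gs).
    by move: gs; case: (s); case: (inside e f).
  have xe : x \in e.
    by apply: (@sideI _ G (inside e f));
      [apply: (subsetP We)|apply: (subsetP gs)].
  have xV := subsetP gV _ xg.
  have [g' [_ _ gu]] := perfect_edge pM xV.
  have ge : g != e.
    by apply: contraNneq zW => ge; apply: (subsetP (sub_cover fR));
      rewrite -ge in ef; apply: (subsetP ef).
  have eM : e \notin M.
    by apply: contra ge => eM; rewrite (gu _ eM xe) (gu _ gM xg).
  have zne : z \notin e by apply: contra ze; apply/subsetP/sub_side/ep.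
  have [h [hF eh hs]] : exists h, [/\ h \in faces, e \subset h & h \subset side
    (~~ inside e f) e].
    by apply: (exists_face hG eE); exists z; split=> //; apply: sideU.
  have hi : inside e h = ~~ inside e f by apply/eqP; rewrite inside_neq.
  have hR : h \notin R.
    by apply/negP => /he; rewrite hi; case: (inside e f).
  have [N [pN eN cN]] := cut e f h eC eM fR ef hF hR eh.
  have [b exb xb] : exists2 b, e = [set x; b] & x != b.
    have /andP[/cards2P[c [d [cd ecd]]] _] := ep eE.
    move: xe; rewrite ecd in_set2 => /orP[] /eqP ->; first by exists d.
    by exists c; rewrite 1?setUC // eq_sym.
  have xh : x \in h by apply: (subsetP eh).
  rewrite -hi in gs.
  have := colour_corner_beyond pM hF eE eh exb xb gM xg ge gs.
  rewrite cN (colour_corner pN hF xh xb) -?exb //.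
  by case: (_ (+) _).
have alt : alternating_cycle G M C.
  have Up := corners_uniq Uc (cover R).
  have sp : 2 < size (corners G (cover R)) by rewrite size_corners.
  exists (corners G (cover R)); split=> //.
    by apply/subsetP => e /bP[].
  move=> x xp; have xW : x \in cover R by rewrite -(mem_corners _ WV).
  have xV := subsetP WV _ xW.
  have [g [gM xg gu]] := perfect_edge pM xV.
  have [_ gE] := cycle_edges_inc Up (inC g x gM xg xW) xg.
  have [nx px np] := next_neq_prev Up sp xp.
  set a := [set x; _] in gE *; set b := [set _; x] in gE *.
  have ab : a != b.
    apply: contra np => /eqP ab;
      have : next (corners G (cover R)) x \in b by rewrite -ab set22.
    by rewrite in_set2 (negbTE nx) orbF.
  have xa : x \in a by rewrite set21.
  have xb : x \in b by rewrite set22.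
  case: gE => gE; rewrite gE in gM gu; rewrite gM.
    by apply/esym; apply: contra ab => bM; rewrite (gu b).
  by apply/negP => aM; case/eqP: ab; rewrite (gu a).
split=> //; first exact: alternating_perfect pM alt.
by move=> f fF; rewrite colour_symdiff /colour boundary_parity.
Qed.

End Colours.

(** * Reconfiguring from a centre *)

Lemma bool_neq (a b : bool) : a != b -> a = ~~ b.
Proof. by case: a; case: b. Qed.

Section Sequences.
Variables (T : finType) (G : drawn_graph T).
Implicit Types (M N Q C : {set {set T}}).

Lemma reconfigures_refl M : perfect_matching G M -> reconfigures_in G M M 0.
Proof. by move=> pM; exists (fun=> M). Qed.

Lemma reconfigures_step M Q C t : reconfigures_in G M Q t ->
  alternating_cycle G Q C -> reconfigures_in G M (symdiff Q C) t.+1.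
Proof.
case=> Ms [M0 Mt pM aM] aC.
have pQ : perfect_matching G Q by rewrite -Mt; apply: pM.
exists (fun i => if i <= t then Ms i else symdiff Q C); split=> //.
- by rewrite ltnn.
- by move=> i _; case: leqP => it; [apply: pM | apply: alternating_perfect].
move=> i; rewrite ltnS => it; rewrite it.
move: it; rewrite leq_eqVlt => /orP[/eqP ->|it].
  by exists C; rewrite ltnn Mt.
by rewrite it; apply: aM.
Qed.

End Sequences.

(** * Distances by separating edges, and flipping all faces on schedule *)

Section Distance.
Variables (T : finType) (G : drawn_graph T).
Hypothesis hG : outerplanar G.
Implicit Types (e f g h c : {set T}) (R M N P : {set {set T}}).

Local Notation E := (edges G).
Local Notation side := (side G).
Local Notation inside := (inside G).
Local Notation faces := (inner_faces G).

Let ep := edge_pair hG.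

Definition separators P c f : {set {set T}} :=
  [set e in P | inside e c != inside e f].

(** For faces and [P = E] this is the distance in the dual tree; for a matching, only the matched
    chords on the way are counted. *)
Definition dist P c f : nat := #|separators P c f|.

Lemma dist0 P c : dist P c c = 0.
Proof.
rewrite /dist (_ : separators P c c = set0) ?cards0 //.
by apply/setP => e; rewrite !inE eqxx andbF.
Qed.

Lemma distC P c f : dist P c f = dist P f c.
Proof. by apply: eq_card => e; rewrite !inE eq_sym. Qed.

Lemma colour_dist P c f : colour G P f = colour G P c (+) odd (dist P c f).
Proof. by rewrite -colour_diff addKb. Qed.

(** [e] is the side of [f] facing [c], and [h] is on the same side of it as [f]: the tree path from
    [c] to [h] runs through [f]. *)
Lemma separators_behind c f h e e' : c \in faces -> f \in faces -> h \in faces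
  ->
  e \in E -> e \subset f -> inside e f != inside e c -> inside e h = inside e f
    ->
  e' \in E -> inside e' f != inside e' c -> inside e' h = inside e' f.
Proof.
move=> cF fF hF eE ef efc ehf e'E e'fc.
have [->//|ne] := eqVneq e' e.
have es : e \subset side (inside e' f) e' := subset_trans ef (face_side hG fF
  e'E).
have [s e's] := edge_side hG eE e'E.
have sub : side (~~ s) e \subset side (inside e' f) e'.
  by apply: side_nested; rewrite ?ep // eq_sym.
have [sE|sE] := eqVneq s (inside e f).
  have : c \subset side (inside e' f) e'.
    apply: subset_trans sub; rewrite sE -(inside_neq hG) //.
    by rewrite (bool_neq efc) negbK.
  by rewrite -(inside_neq hG) // eq_sym (negbTE e'fc).
apply/eqP; rewrite (inside_neq hG) //; apply: subset_trans sub.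
by rewrite -(inside_neq hG) // ehf (bool_neq sE) negbK.
Qed.

Lemma dist_behind P c f h e : P \subset E -> c \in faces -> f \in faces ->
  h \in faces -> e \in E -> e \subset f -> inside e f != inside e c ->
  inside e h = inside e f -> dist P c f <= dist P c h.
Proof.
move=> PE cF fF hF eE ef efc ehf; apply/subset_leq_card/subsetP => e'.
rewrite !inE => /andP[e'P]; rewrite e'P eq_sym => nc.
by rewrite (separators_behind cF fF hF eE ef efc ehf (subsetP PE _ e'P) nc)
  eq_sym.
Qed.

Lemma dist_share P c f g e : P \subset E -> c \in faces -> f \in faces ->
  g \in faces -> f != g -> e \in E -> e \subset f -> e \subset g ->
  dist P c g + ((e \in P) && (inside e c != inside e f)) =
  dist P c f + ((e \in P) && (inside e c == inside e f)).
Proof.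
move=> PE cF fF gF ne eE ef eg; rewrite /dist.
have [ie _] := share_inside hG fF gF ne eE ef eg.
rewrite (cardsD1 e (separators P c g)) (cardsD1 e (separators P c f)) !inE ie.
rewrite (_ : separators P c g :\ e = separators P c f :\ e).
  move: #|_ :\ _| => n.
  by case: (e \in P); case: (inside e c); case: (inside e f); clear; lia.
apply/setP => e'; rewrite !inE; have [//|e'e] := eqVneq e' e.
have [e'P|//] := boolP (e' \in P).
by rewrite (share_inside_other hG fF gF ne eE ef eg (subsetP PE _ e'P) e'e).
Qed.

(* At time i the colour of f is that of cM plus max (dM f) (min i (k - dN f)). *)
(* Distinct centres for M and N are needed when the middle of the dual tree is *)
(* a common chord of M and N.                                                  *)
Lemma reconfigure_from_centres M N cM cN k :
  perfect_matching G M -> perfect_matching G N -> cM \in faces -> cN \in faces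
    ->
  (forall f, f \in faces -> dist M cM f + dist N cN f <= k) ->
  odd k = colour G M cM (+) colour G N cN ->
  exists2 t, t <= k & reconfigures_in G M N t.
Proof.
move=> pM pN cMF cNF dk ok; case: (pM) => ME _; case: (pN) => NE _.
(* Face [f] flips at the times in the window from [a f] up to but excluding [b f]; before it [f] has
   its colour in [M], after it the one in [N]. *)
pose a f := dist M cM f; pose b f := k - dist N cN f.
have ab f : f \in faces -> a f <= b f by move=> /dk; rewrite /a /b; clear; lia.
pose clamp i f := maxn (a f) (minn i (b f)).
have clamp_b i f : f \in faces -> b f <= i ->
    colour G M cM (+) odd (clamp i f) = colour G N f.
  move=> fF bi; have -> : clamp i f = b f.
    by rewrite /clamp (minn_idPr bi) (maxn_idPr (ab f fF)).
  rewrite /b oddB; last by have := dk f fF; clear; lia.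
  rewrite ok (colour_dist N cN f).
  by case: (colour G M cM); case: (colour G N cN); case: (odd _).
suff main i : i <= k -> exists Q t, [/\ t <= i, reconfigures_in G M Q t &
    forall f, f \in faces -> colour G Q f = colour G M cM (+) odd (clamp i f)].
  have [Q [t [tk rQ cQ]]] := main k (leqnn k); exists t => //.
  have pQ : perfect_matching G Q by case: rQ => Ms [_ <- + _]; apply.
  rewrite -(_ : Q = N) //; apply: (eq_colour hG) => // f fF.
  by rewrite cQ // clamp_b // /b leq_subr.
elim: i => [_|i IH ik].
  exists M, 0; split=> // [|f fF]; first exact: reconfigures_refl.
  by rewrite (colour_dist M cM f) /clamp min0n maxn0.
have [Q [t [ti rQ cQ]]] := IH (ltnW ik).
have pQ : perfect_matching G Q by case: rQ => Ms [_ <- + _]; apply.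
case: (pQ) => QE _.
pose R := [set f in faces | a f <= i < b f].
have clampS f : f \in faces -> odd (clamp i.+1 f) = odd (clamp i f) (+) (f \in
  R).
  move=> fF; rewrite [f \in R]inE fF /=; have := ab f fF.
  have [aib|] := boolP (a f <= i < b f) => abf.
    rewrite addbT -oddS; congr odd.
    by move: aib abf; rewrite /clamp; clear; lia.
  rewrite addbF => naib; congr odd; move: abf naib; rewrite /clamp; clear; lia.
(* If no face flips at this time, no cycle is spent; hence only [t <= k]. *)
have [R0|Rn0] := eqVneq R set0.
  exists Q, t; split=> // [|f fF]; first exact: leqW.
  by rewrite clampS // R0 inE addbF cQ.
have gR : gated G R.
  split=> //; first by apply/subsetP => f; rewrite inE => /andP[].
  (* A face not yet in its window is farther from [cM] than all of [R], one past it farther from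
     [cN]. The side facing that centre is a gate, because distances do not decrease behind the
     face. *)
  have gate c P f : P \subset E -> c \in faces -> f \in faces -> f != c ->
      (forall h, h \in R -> dist P c h < dist P c f) ->
      exists e, [/\ e \in E, e \subset f &
        forall h, h \in R -> inside e h = ~~ inside e f].
    move=> PE cF fF fc hlt; have [e [ei ef efc]] := face_sep hG fF cF fc.
    have eE : e \in E by move: ei; rewrite inE => /andP[].
    exists e; split=> // h hR; apply: bool_neq.
    apply/eqP => eqh; have := hlt h hR; rewrite ltnNge => /negP[].
    apply: (dist_behind PE cF fF _ eE ef efc) => //.
    by move: hR; rewrite inE => /andP[].
  move=> f fF; rewrite inE fF /= negb_and -ltnNge -leqNgt => /orP[ai|bi].
    apply: (gate cM M) => //; first by apply: contraTneq ai => ->;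
      rewrite /a dist0.
    by move=> h; rewrite inE => /and3P[_ ah _]; apply: leq_ltn_trans ah ai.
  apply: (gate cN N) => //.
    by apply: contraTneq bi => ->; rewrite /b dist0 subn0 -ltnNge.
  move=> h; rewrite inE => /and3P[hF _ bh].
  by move: bi bh; rewrite /b; clear; lia.
have RF f : f \in R -> f \in faces by rewrite inE => /andP[].
have cR f : f \in R -> colour G Q f = colour G M cM (+) odd i.
  move=> fR; rewrite cQ ?RF //; congr (_ (+) odd _).
  by move: fR; rewrite inE /clamp => /andP[_]; clear; lia.
have [||aC pC cC] := flip_region hG pQ gR.
- by move=> f f' fR f'R; rewrite !cR.
(* If [g] were still waiting, its clamped time would be one more than that of [f]; the colours would
   differ and [e] would be in [Q]. So [g] has finished and has its colour in [N], and ending earlier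
   than [f] it is separated from [f] by an edge of [N], namely [e]. *)
- move=> e f g eC eQ fR ef gF gR' eg; exists N.
  have fF := RF f fR; have [eE _] := boundaryP hG gR _ eC.
  have fg : f != g by apply: contraNneq gR' => <-.
  have := colour_share hG QE fF gF fg eE ef eg; rewrite (negbTE eQ) addbF.
  have dM := dist_share ME cMF fF gF fg eE ef eg.
  have dN := dist_share NE cNF fF gF fg eE ef eg.
  move: fR gR'; rewrite [f \in R]inE [g \in R]inE gF fF /= negb_and -ltnNge
    -leqNgt => /andP[afi ibf].
  have abg := ab g gF.
  case/orP => [iag|bgi] ceq.
    move: ceq; rewrite !cQ // => /addbI.
    have -> : clamp i g = (clamp i f).+1.
      move: dM afi ibf iag abg; rewrite /clamp -/(a g) -/(a f).
      by case: (e \in M); case: (inside e cM == inside e f); clear; lia.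
    by rewrite oddS; case: (odd _).
  rewrite cQ // clamp_b //; split=> //.
  apply: contraTT bgi => eN; move: dN ibf;
    rewrite (negbTE eN) /= !addn0 /b => ->.
  by rewrite ltnNge.
exists (symdiff Q (cycle_edges (corners G (cover R)))), t.+1; split=> //.
  exact: reconfigures_step.
by move=> f fF; rewrite cC // cQ // clampS // addbA.
Qed.

End Distance.

(** * The gap as a bound for the dual tree *)

Section Gap.
Variables (T : finType) (G : drawn_graph T).
Hypothesis hG : outerplanar G.
Implicit Types (e f g h c : {set T}) (M N P : {set {set T}}).

Local Notation V := (vertices G).
Local Notation E := (edges G).
Local Notation inside := (inside G).
Local Notation faces := (inner_faces G).
Local Notation dist := (dist G).

Let ep := edge_pair hG.

(** [c] is on the tree path from [f] to [g], so no edge of [P] cuts it off from both. *)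
Lemma dist_between P c f g e : P \subset E -> c \in faces -> f \in faces ->
  g \in faces -> e \in E -> e \subset c -> inside e f != inside e c ->
  inside e g = inside e c -> dist P f g = dist P c f + dist P c g.
Proof.
move=> PE cF fF gF eE ec efc egc; rewrite -cardsUI.
have nn e' : e' \in P -> inside e' c != inside e' f -> inside e' g = inside e'
  c.
  move=> e'P; apply: (separators_behind hG fF cF gF eE ec _ egc) => //.
    by rewrite eq_sym.
  exact: (subsetP PE).
rewrite [X in _ + X](_ : _ = 0) ?addn0; last first.
  apply/eqP; rewrite cards_eq0; apply/eqP/setP => e'; rewrite !inE.
  have [e'P|//] := boolP (e' \in P); have := nn e' e'P.
  by case: (inside e' c); case: (inside e' f);
    case: (inside e' g) => // /(_ isT).
apply: eq_card => e'; rewrite !inE; have [e'P|//] := boolP (e' \in P).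
by have := nn e' e'P; case: (inside e' c); case: (inside e' f);
  case: (inside e' g) => // /(_ isT).
Qed.

Lemma dist_neighbour P h c c' e : P \subset E -> h \in faces -> c \in faces ->
  c' \in faces -> c != c' -> e \in E -> e \subset c -> e \subset c' ->
  dist P c' h + ((e \in P) && (inside e h != inside e c)) =
  dist P c h + ((e \in P) && (inside e h == inside e c)).
Proof.
move=> PE hF cF c'F ne eE ec ec'.
by rewrite !(distC _ _ _ h); apply: dist_share.
Qed.

Lemma neighbour_towards c f : c \in faces -> f \in faces -> c != f ->
  exists c' e, [/\ c' \in faces, c != c', e \in E, e \subset c /\ e \subset c'
    & inside e f != inside e c].
Proof.
move=> cF fF cf; have [e [ei ec ie]] := face_sep hG cF fF cf.
have eE : e \in E by move: ei; rewrite inE => /andP[].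
have [c' [c'F ec' ie']] := neighbour hG cF ei ec.
exists c', e; split=> //; last by rewrite eq_sym.
by apply/eqP => cc'; move: ie'; rewrite -cc'; case: (inside e c).
Qed.

Lemma shared_chord f g e : f \in faces -> g \in faces -> f != g ->
  e \in E -> e \subset f -> e \subset g -> shared_chords G f g = [set e].
Proof.
move=> fF gF ne eE ef eg; apply/setP => e'.
have [ie ei] := share_inside hG fF gF ne eE ef eg.
rewrite [LHS]inE [RHS]inE; apply/and3P/eqP => [[e'i e'f e'g]|->];
  last by rewrite ef.
have e'E : e' \in E by move: e'i; rewrite inE => /andP[].
have [//|ne'] := eqVneq e' e.
have [ie' _] := share_inside hG fF gF ne e'E e'f e'g.
have := share_inside_other hG fF gF ne eE ef eg e'E ne'.
by rewrite ie'; case: (inside e' f).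
Qed.

Lemma dual_length_share M N f g e : f \in faces -> g \in faces -> f != g ->
  e \in E -> e \subset f -> e \subset g ->
  dual_length G M N (f, false) (g, false) = (e \in M) + (e \in N).
Proof.
move=> fF gF ne eE ef eg; rewrite /dual_length /= (negbTE ne).
rewrite (shared_chord fF gF ne eE ef eg) big_set1.
have h (A : {set {set T}}) : #|A :&: [set e]| = (e \in A).
  have [eA|eA] := boolP (e \in A).
    by rewrite (setIidPr _) ?cards1 // sub1set.
  apply/eqP; rewrite cards_eq0; apply/eqP/setP => e'; rewrite !inE.
  by apply/negbTE; rewrite negb_and; case: eqP => [->|]; rewrite ?eA ?orbT.
by rewrite !h.
Qed.

Lemma dual_adj_share f g e : f \in faces -> g \in faces -> f != g ->
  e \in E -> e \subset f -> e \subset g -> dual_adj G (f, false) (g, false).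
Proof.
move=> fF gF ne eE ef eg;
  rewrite /dual_adj ![_ \in dual_nodes G]inE /= (negbTE ne).
rewrite fF gF /= (shared_chord fF gF ne eE ef eg).
by apply/set0Pn; exists e; rewrite inE.
Qed.

Variables M N : {set {set T}}.
Hypotheses (pM : perfect_matching G M) (pN : perfect_matching G N).

Let ME : M \subset E. Proof. by case: pM. Qed.
Let NE : N \subset E. Proof. by case: pN. Qed.

Let len f g : nat := dist M f g + dist N f g.
Let bit f : bool := colour G M f (+) colour G N f.

(** Move across a side facing [g] again and again: each move removes exactly one separator, so the
    lengths add up to [len f g] and no face is repeated. *)
Lemma dual_walk f g : f \in faces -> g \in faces -> exists p,
  [/\ dual_path G (f, false) (g, false) p, all (fun u => ~~ u.2) p &
      walk_length G M N (f, false) p = len f g].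
Proof.
move=> fF gF; suff [p [pth lst al wl lt]] : exists p,
    [/\ path (dual_adj G) (f, false) p, last (f, false) p = (g, false),
    all (fun u => ~~ u.2) p, walk_length G M N (f, false) p = len f g
    & path (fun u v => dist E v.1 g < dist E u.1 g) (f, false) p].
  exists p; split=> //; rewrite /dual_path pth lst eqxx.
  pose closer := [rel u v : dual_node T | dist E v.1 g < dist E u.1 g].
  have tr : transitive closer by move=> y x z h1 h2; apply: ltn_trans h2 h1.
  by apply: (sorted_uniq tr _ (s := _ :: _) lt) => x; rewrite /= ltnn.
have [n] := ubnP (dist E f g); elim: n f fF => // n IH f fF.
have [->|ne] := eqVneq f g.
  by exists [::]; split=> //; rewrite /len !dist0.
rewrite ltnS => fn.
have [f' [e [f'F ff' eE [ef ef'] ie]]] := neighbour_towards fF gF ne.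
have d P : P \subset E -> dist P f g = (e \in P) + dist P f' g.
  move=> PE; have := dist_neighbour PE gF fF f'F ff' eE ef ef'.
  by rewrite (negbTE ie) andbF andbT addn0 addnC => ->.
have := d E (subxx _); rewrite eE => dE.
have [|p [pth lst al wl lt]] := IH f' f'F; first by rewrite dE in fn.
exists ((f', false) :: p); split=> //=.
- by rewrite pth andbT; apply: dual_adj_share eE ef ef'.
- by rewrite (dual_length_share M N fF f'F ff' eE ef ef') wl /len !d // addnACA.
- by rewrite lt andbT dE.
Qed.

Lemma leq_gap u v p : dual_path G u v p -> walk_length G M N u p <= gap G M N.
Proof.
move=> dp; have /and3P[pth /eqP lst un] := dp.
case: p dp pth lst un => [//|w p] dp pth lst un.
have inD a b : dual_adj G a b -> (a \in dual_nodes G) && (b \in dual_nodes G).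
  by rewrite /dual_adj => /and3P[-> ->].
have uD : u \in dual_nodes G by case/andP: pth => /inD/andP[].
have vD : v \in dual_nodes G.
  rewrite -lst; move: (pth); rewrite lastI rcons_path => /andP[_ /inD/andP[_]].
  by rewrite last_rcons.
have sz : size (w :: p) <= #|dual_node T|.
  have /andP[_ uwp] : (u \notin w :: p) && uniq (w :: p) := un.
  by rewrite -(card_uniqP uwp); exact: (@max_card (dual_node T) (mem (w :: p))).
rewrite /gap (bigD1 u) //= leq_max; apply/orP; left.
rewrite (bigD1 v) //= leq_max; apply/orP; left.
by rewrite (bigD1 (Bseq sz)) //= leq_max leqnn.
Qed.

Lemma walk_length_rcons u p v : walk_length G M N u (rcons p v) =
  walk_length G M N u p + dual_length G M N (last u p) v.
Proof. by elim: p u => [|w p IH] u /=; rewrite ?addn0 // IH addnA. Qed.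

(* A leaf copy of f can only be used to end a path where f touches the outer   *)
(* face, and contributes to the length exactly when bit f holds.               *)
Definition tip f := (outer_part G f != set0) || ~~ bit f.

Lemma dual_length_tip f b : f \in faces -> bit f ->
  dual_length G M N (f, b) (f, ~~ b) = 1.
Proof.
move=> fF bf; rewrite /dual_length eqxx /=; apply/eqP; rewrite eqb1.
apply/subsetP => e; rewrite inE => /andP[eo ef]; rewrite in_symdiff.
have := colour_outer hG pM pN fF eo ef; move: bf; rewrite /bit.
by case: (e \in M); case: (e \in N); case: (colour G M f); case: (colour G N f).
Qed.

Lemma leq_gap_tips f g : f \in faces -> g \in faces -> f != g -> tip f -> tip g
  ->
  len f g + bit f + bit g <= gap G M N.
Proof.
move=> fF gF ne tf tg; have [p [dp ap <-]] := dual_walk fF gF.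
have /and3P[pth /eqP lst un] := dp.
have notin S : (S, true) \notin (f, false) :: p.
  by apply/negP; rewrite in_cons xpair_eqE andbF => /(allP ap).
have adj S b : S \in faces -> tip S -> bit S -> dual_adj G (S, b) (S, ~~ b).
  move=> SF tS bS; rewrite /dual_adj ![_ \in dual_nodes G]inE /= SF eqxx /=.
  by move: tS; rewrite /tip bS orbF => ->; rewrite !implybT; case: b.
have [q [dq wq hq]] : exists q, [/\ dual_path G (f, false) (last (f, false) q)
  q,
   walk_length G M N (f, false) q = walk_length G M N (f, false) p + bit g
   & (f, true) \notin q].
  have [bg|bg] := boolP (bit g); last first.
    exists p; rewrite addn0 lst; split=> //.
    by have := notin f; rewrite in_cons negb_or => /andP[].
  exists (rcons p (g, true)); rewrite last_rcons; split.
  - rewrite /dual_path rcons_path pth last_rcons eqxx lst -rcons_cons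
    rcons_uniq.
    by rewrite notin un (adj g false).
  - by rewrite walk_length_rcons lst (dual_length_tip false gF bg).
  have := notin f; rewrite mem_rcons !in_cons !negb_or => /andP[_ ->].
  by rewrite /= ne.
have [bf|bf] := boolP (bit f); last first.
  by rewrite addn0 -wq; apply: leq_gap dq.
have := @leq_gap (f, true) (last (f, false) q) ((f, false) :: q).
rewrite /= (dual_length_tip true fF bf) wq => le.
suff /le : dual_path G (f, true) (last (f, false) q) ((f, false) :: q).
  by clear; lia.
have /and3P[pq lq uq] := dq.
rewrite /dual_path /= pq (adj f true) // eqxx /= -[uniq q]andTb.
move: uq => /= /andP[-> ->]; rewrite inE negb_or hq !andbT.
by rewrite xpair_eqE andbF.
Qed.

Lemma odd_len f g : odd (len f g) = bit f (+) bit g.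
Proof.
rewrite /len oddD /bit (colour_dist _ M f g) (colour_dist _ N f g).
by case: (colour G M f); case: (colour G N f); case: (odd _); case: (odd _).
Qed.

(** Leave a face that is no tip across a side other than the one facing [g]. An edge of exactly one
    matching clears the bit but adds 1 to the length; any other edge keeps the bit. The total never
    drops, and the distance from [g] is bounded by the number of edges. *)
Lemma extend_to_tip f g : f \in faces -> g \in faces -> f != g -> exists f',
  [/\ f' \in faces, f' != g, tip f' & len g f + bit f <= len g f' + bit f'].
Proof.
have [n] := ubnP (#|E| - dist E g f); elim: n f => // n IH f.
rewrite ltnS => fn fF gF ne.
have [tf|] := boolP (tip f); first by exists f.
rewrite negb_or !negbK => /andP[/eqP no bf].
have [e0 [e0i e0f ie0]] := face_sep hG fF gF ne.
have e0E : e0 \in E by move: e0i; rewrite inE => /andP[].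
have [z zf ze0] : exists2 z, z \in f & z \notin e0.
  by apply/subsetPn/negP; apply: (big_not_sub (ep e0E) (face_card hG fF)).
have [e [eE ef ee0]] : exists e, [/\ e \in E, e \subset f & e != e0].
  have [fV f3 _] := faceP hG _ fF.
  have zc : z \in corners G f by rewrite mem_corners.
  have eC := next_edge zc; exists [set z; next (corners G f) z].
  move: fF; rewrite inE => /and3P[_ _ /eqP fE]; move: eC;
    rewrite fE inE => /andP[-> ->].
  by split=> //; apply: contraNneq ze0 => <-; rewrite set21.
have ei : e \in inner_edges G.
  rewrite inE eE andbT; apply/negP => eo.
  have : e \in outer_part G f by rewrite inE eo.
  by rewrite no inE.
have [f' [f'F ef' ie']] := neighbour hG fF ei ef.
have ff' : f != f' by apply/eqP => eqf; move: ie'; rewrite -eqf;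
  case: (inside e f).
have ige : inside e g = inside e f.
  apply/eqP; rewrite (inside_neq hG) //.
  have e0s : e0 \subset side G (inside e f) e := subset_trans e0f (face_side hG
    fF eE).
  have es : e \subset side G (inside e0 f) e0 := subset_trans ef (face_side hG
    fF e0E).
  have := side_nested (ep e0E) (ep eE) _ es e0s; rewrite eq_sym => /(_ ee0).
  apply: subset_trans; rewrite -(inside_neq hG) // eq_sym.
  by move: ie0; case: (inside e0 f); case: (inside e0 g).
have d P : P \subset E -> dist P g f' = dist P g f + (e \in P).
  move=> PE; have := dist_neighbour PE gF fF f'F ff' eE ef ef'.
  by rewrite !(distC _ _ g) ige eqxx andbF andbT addn0.
have [||f'' [f''F ne'' tf'' le]] := IH f' _ f'F gF.
- have : dist E g f' <= #|E| by apply/subset_leq_card/subsetP => ?;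
  rewrite inE => /andP[].
  by move: fn; rewrite d // eE; clear; lia.
- by apply/eqP => eqf; move: ie'; rewrite eqf ige; case: (inside e f).
exists f''; split=> //; apply: leq_trans le.
have := odd_len g f'; have := odd_len g f; rewrite /len !d // bf.
rewrite !oddD; case: (bit g); case: (bit f'); case: (e \in M); case: (e \in N);
case: (odd _); case: (odd _) => //=; clear; lia.
Qed.

Lemma leq_gap_faces f g : f \in faces -> g \in faces -> f != g ->
  len f g + bit f + bit g <= gap G M N.
Proof.
move=> fF gF ne; have [f' [f'F nf' tf' le1]] := extend_to_tip fF gF ne.
rewrite eq_sym in nf'; have [g' [g'F ng' tg' le2]] := extend_to_tip gF f'F nf'.
rewrite eq_sym in ng'; apply: leq_trans (leq_gap_tips f'F g'F ng' tf' tg').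
have lenC a b : len a b = len b a by rewrite /len !(distC _ _ a).
rewrite (lenC f g); move: le1 le2; rewrite (lenC f' g); clear; lia.
Qed.

(** Without it, a single face whose outer edges all lie in the symmetric difference would have gap
    1, yet need one flip. *)
Hypothesis not_cycle : inner_edges G = set0 ->
  exists2 e, e \in outer_edges G & (e \in M) = (e \in N).

(* A face c of least eccentricity r is a centre with k = r, unless the step    *)
(* towards a farthest face crosses a common chord without increasing the       *)
(* eccentricity; then the two faces at that chord are centres with k = r - 1.  *)
Lemma reconfigure_half_gap :
  exists2 t, t.*2 <= gap G M N & reconfigures_in G M N t.
Proof.
(* The term [bit f] accounts for the leaf copy of the far face. *)
pose ecc c := \max_(f in faces) (len c f + bit f).
have le_ecc c f : f \in faces -> len c f + bit f <= ecc c.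
  by move=> fF; apply: (leq_bigmax_cond (F := fun f => len c f + bit f)).
have [f0 f0F] : exists f, f \in faces.
  have [|e [eC _ _]] := polygon_top hG (subxx V).
    rewrite -(size_corners (circ_uniq hG) (subxx _)) cornersT.
    by apply: ltnW; apply: circ_size hG.
  rewrite cornersT in eC.
  by have [f fF _] := edge_face hG (subsetP (outer_sub hG) _ eC); exists f.
have ecc_at c : exists2 f, f \in faces & len c f + bit f = ecc c.
  have [|f fF fE] := eq_bigmax_cond (A := mem faces) (fun f => len c f + bit f).
    by apply/card_gt0P; exists f0.
  by exists f => //; apply: esym; exact: fE.
have [c0 c0F cmin] : exists2 c0, c0 \in faces & forall c, c \in faces -> ecc c0
  <= ecc c.
  by case: (@arg_minnP _ f0 (fun f => f \in faces) ecc f0F) => c0 ? ?;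
    exists c0.
set r := ecc c0 in cmin.
(* Choosing the fewest steps between centre and farthest face ensures that the first chord on the
   way cannot be outside both matchings. *)
pose P (cf : {set T} * {set T}) := [&& cf.1 \in faces, cf.2 \in faces,
  ecc cf.1 == r & len cf.1 cf.2 + bit cf.2 == r].
have [f1 f1F f1E] := ecc_at c0.
have P0 : P (c0, f1) by rewrite /P /= c0F f1F f1E eqxx.
case: (arg_minnP (fun cf => dist E cf.1 cf.2) P0) => -[c f].
case/and4P => /= cF fF /eqP ecr /eqP fr dmin {P0 f1 f1F f1E}.
have oddr : odd r = bit c by rewrite -fr oddD odd_len oddb -addbA addbb addbF.
(* One centre with [k = r] has the right parity by [oddr]. *)
have single : r.*2 <= gap G M N -> exists2 t, t.*2 <= gap G M N &
  reconfigures_in G M N t.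
  move=> rg; have [|t tr rt] := reconfigure_from_centres hG pM pN cF cF _ oddr.
    move=> h hF; apply: leq_trans (_ : ecc c <= r); last by rewrite ecr.
    by apply: leq_trans (le_ecc c h hF); apply: leq_addr.
  by exists t => //; apply: leq_trans rg; rewrite leq_double.
have [eqcf|ncf] := eqVneq c f.
  have rb : r = bit c by rewrite -fr -eqcf /len !dist0.
  have [bc|bc] := boolP (bit c); last by apply: single; rewrite rb (negbTE bc).
  have [h /andP[hF hc]|nh] := pickP (fun h => (h \in faces) && (h != c)).
    apply: single; apply: leq_trans (leq_gap_faces hF cF hc).
    have := odd_len h c; rewrite rb bc.
    by case: (bit h); case: (len h c) => [|n] //= _; rewrite ?addn0 ?addn1.
  case/negP: bc; have one h : h \in faces -> h = c.
    by move=> hF; apply/eqP; have := nh h; rewrite hF /= => /negbFE.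
  have [|e eo eMN] := not_cycle.
    apply/setP => e; rewrite in_set0; apply/negP => ei.
    have eE : e \in E by move: ei; rewrite inE => /andP[].
    have [h hF eh] := edge_face hG eE.
    have [h' [h'F _]] := neighbour hG hF ei eh.
    by rewrite (one h hF) (one h' h'F); case: (inside e c).
  have [h hF eh] := edge_face hG (subsetP (outer_sub hG) _ eo).
  have := colour_outer hG pM pN hF eo eh;
    rewrite eMN eqxx (one h hF) /bit => /eqP ->.
  by rewrite addbb.
have [c' [e [c'F cc' eE [ec ec'] ief]]] := neighbour_towards cF fF ncf.
have nb (Q : {set {set T}}) (h : {set T}) : Q \subset E -> h \in faces ->
    dist Q c' h + ((e \in Q) && (inside e h != inside e c)) =
    dist Q c h + ((e \in Q) && (inside e h == inside e c)).
  by move=> QE hF; apply: dist_neighbour.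
have [g gF gE] := ecc_at c'.
have rc' := cmin c' c'F.
have oddc' : odd (ecc c') = bit c (+) (e \in M) (+) (e \in N).
  rewrite -gE oddD odd_len oddb -addbA addbb addbF /bit.
  rewrite (colour_share hG ME cF c'F cc' eE ec ec') (colour_share hG NE cF c'F
    cc' eE ec ec').
  by case: (colour G M c); case: (colour G N c); case: (e \in M);
    case: (e \in N).
have gle := le_ecc c g gF; rewrite ecr in gle.
have between : inside e g == inside e c -> len f g + bit f + bit g <= gap G M N
  /\
    len f g = len c f + len c g.
  move=> /eqP igc; split.
    apply: leq_gap_faces => //.
    by apply/eqP => fg; move: ief; rewrite fg igc eqxx.
  by rewrite /len !(dist_between _ cF fF gF eE ec ief igc) //; clear; lia.
have nM := nb M g ME gF; have nN := nb N g NE gF.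
(* Crossing [e] brings the faces beyond it closer by the length of [e] and moves the others away by
   as much. If that length is positive and the eccentricity grows by all of it, then [g] is on the
   side of [c] at distance [r], and the path from [f] through [c] to [g] has length [2r]. *)
have [far|near] := boolP (ecc c' < r + (e \in M) + (e \in N)); last first.
  have [eMN|eMN] := boolP ((e \in M) || (e \in N)); last first.
    have fE : P (c', f).
      have nMf := nb M f ME fF; have nNf := nb N f NE fF.
      move: nMf nNf nM nN eMN gE gle rc' fr; rewrite /P /= c'F fF /len.
      case: (e \in M) => //; case: (e \in N) => //= h1 h2 h3 h4 _ h5 h6 h7 h8.
      by clear -h1 h2 h3 h4 h5 h6 h7 h8; apply/andP; split; apply/eqP; lia.
    have := dmin _ fE; have := nb E f (subxx _) fF.
    by rewrite /= eE ief (negbTE ief) /= addn0 addn1 => <-; rewrite ltnn.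
  move: nM nN; have [igc|igc] := boolP (inside e g == inside e c) => nM nN.
    have [le eqs] := between igc; apply: single; apply: leq_trans le.
    rewrite eqs; move: nM nN near gE fr; rewrite /= !andbF !andbT /len -leqNgt.
    have ar (m' n' m n k b bf r0 d x y : nat) : m' + 0 = m + x -> n' + 0 = n +
      y ->
      r0 + x + y <= k -> m' + n' + b = k -> d + bf = r0 ->
      r0.*2 <= d + (m + n) + bf + b by clear; lia.
    exact: ar.
  exfalso; move: nM nN near gE gle eMN; rewrite /= !andbF !andbT /len -leqNgt.
  by clear; case: (e \in M); case: (e \in N) => //=; lia.
(* The eccentricity of [c'] is at least [r], less than [r] plus the length of [e], and differs from
   [r] by that length modulo 2. This leaves only length 2. *)
have [eM eN] : (e \in M) /\ (e \in N).
  move: far oddc' rc' oddr; case: (e \in M); case: (e \in N) => //= h1 h2 h3 h4.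
  - have rE : ecc c' = r by clear -h1 h3; lia.
    by move: h2; rewrite rE h4; case: (bit c).
  - have rE : ecc c' = r by clear -h1 h3; lia.
    by move: h2; rewrite rE h4; case: (bit c).
  - by exfalso; clear -h1 h3; lia.
rewrite eM eN /= in nM nN far oddc' nb.
have eccr : ecc c' = r.
  apply/eqP; rewrite eqn_leq rc' andbT -ltnS ltn_neqAle -ltnS -[r.+2]addn2.
  have -> : ecc c' < r + 2 by move: far; clear; lia.
  rewrite andbT; apply/eqP => er; move: oddc'; rewrite er oddS oddr.
  by case: (bit c).
have igc : inside e g == inside e c.
  apply: contraT => igc; rewrite (negbTE igc) /= in nM nN.
  by move: nM nN gE gle; rewrite eccr /len; clear; lia.
rewrite igc /= in nM nN.
have [le eqs] := between igc.
(* Measuring [M] from [c'] and [N] from [c] counts [e] once for every face: one less than the larger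
   of [len c h] and [len c' h]. The path from [f] to [g] has length [2r - 2]. *)
have [||t tr rt] := @reconfigure_from_centres _ _ hG M N c' c r.-1 pM pN c'F cF.
- move=> h hF; have hM := nb M h ME hF; have hN := nb N h NE hF.
  have h1 := le_ecc c h hF; have h2 := le_ecc c' h hF; rewrite ecr in h1;
    rewrite eccr in h2.
  move: hM hN h1 h2; rewrite eM eN /len /=.
  by case: (inside e h == inside e c); clear; lia.
- have r0 : 0 < r by move: gE nM; rewrite eccr /len; clear; lia.
  rewrite -[LHS]negbK -oddS (prednK r0) oddr (colour_share hG ME cF c'F cc' eE
    ec ec') eM.
  by rewrite /bit; case: (colour G M c); case: (colour G N c).
exists t => //; apply: leq_trans le; rewrite eqs.
move: tr nM nN gE fr; rewrite eccr /len; clear; lia.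
Qed.

End Gap.

(** * Region graphs are outerplanar *)

Lemma connect_leave (T : finType) (r : rel T) (A : pred T) x y :
  connect r x y -> ~~ A x -> A y -> exists u v, [/\ r u v, ~~ A u & A v].
Proof.
case/connectP => p pth -> {y}; elim: p x pth => [|z p IH] x /=.
  by move=> _ /negP nA A'.
case/andP=> xz pth nA Al; have [Az|nAz] := boolP (A z); first by exists x, z.
exact: IH pth nAz Al.
Qed.

(** * 2-connected outerplane graphs satisfy [outerplanar] *)

Section FromDefs.
Variables (T : finType) (G : drawn_graph T).
Implicit Types (e f S : {set T}) (x y z u v : T).

Local Notation V := (vertices G).
Local Notation pos := (position G).

Hypothesis hG : outerplane G.

Let Uc : uniq (circ G). Proof. by case: hG. Qed.

Lemma outerplane_pair e : e \in edges G -> pair G e.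
Proof. by case: hG => _ h _ /h[e2 eV]; rewrite /pair e2 eqxx. Qed.

Lemma outerplane_side e f : e \in edges G -> f \in edges G ->
  exists s, f \subset side G s e.
Proof.
move=> eE fE; have [_ _ nc] := hG.
have /pairP[a [b [eab aV bV ab]]] := outerplane_pair eE.
have /pairP[u [v [fuv uV vV uv]]] := outerplane_pair fE.
rewrite eab in eE; rewrite fuv in fE.
have n1 := nc a b u v; have n2 := nc u v a b.
rewrite -!/(pos _) in n1 n2.
pose ok s := [|| pos u == pos a, pos u == pos b | (pos a < pos u < pos b) == s]
  && [|| pos v == pos a, pos v == pos b | (pos a < pos v < pos b) == s].
have [s oks] : exists s, ok s.
  have h1 : ~ [&& pos a < pos u, pos u < pos b & pos b < pos v].
    by case/and3P => h1 h2 h3; apply: (n1 h1 h2 h3).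
  have h2 : ~ [&& pos u < pos a, pos a < pos v & pos v < pos b].
    by case/and3P => h3 h4 h5; apply: (n2 h3 h4 h5).
  have [|h3] := boolP (ok true); first by exists true.
  exists false; move: h1 h2 h3; rewrite /ok; clear -ab uv.
  move: (pos a) (pos b) (pos u) (pos v) ab uv => pa pb pu pv; lia.
exists s; rewrite fuv eab; apply/subsetP => z; rewrite in_set2.
by case/orP => /eqP ->; rewrite in_side_set2 //; case/andP: oks.
Qed.

Hypothesis hG2 : two_connected G.

Lemma outerplane_size : 2 < size (circ G).
Proof. by case: hG2; rewrite -(size_corners Uc (subxx _)) cornersT. Qed.

(** Suppose the consecutive vertices [x] and [y] are not adjacent. Among the edges [xz] take one
    whose side containing [y] has fewest vertices. Without [z] there is still a path from [x] to
    [y]; it can enter that side only from [x], along an edge [xv], and the side of [xv] containing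
    [y] is strictly smaller. *)
Lemma two_connected_outer : outer_edges G \subset edges G.
Proof.
have [V3 conn] := hG2; apply/subsetP => p po.
have sz : 1 < size (circ G) := ltnW outerplane_size.
have /(outer_edgesP Uc _ sz)[pp [s0 Vs0]] := po.
have /pairP[x [y [pxy xV yV xy]]] := pp.
have nxy : x != y by rewrite (pos_eq _ xV) neq_ltn xy.
apply: contraT => pE.
have step (X : {set T}) (A : pred T) : X \subset V -> #|X| < 2 -> x \notin X ->
    y \notin X -> ~~ A x -> A y -> exists u v,
    [/\ u \in V :\: X, v \in V :\: X, [set u; v] \in edges G, ~~ A u & A v].
  move=> XV X2 xX yX Ax Ay.
  have c := conn X XV X2 x y; rewrite !in_setD xX yX xV yV in c.
  have [u [v [/and3P[uX vX uv] Au Av]]] := connect_leave (c isT isT) Ax Ay.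
  by exists u, v.
pose P z := ([set x; z] \in edges G).
have [z0 Pz0] : exists z, P z.
  have [||||||u [v [_ _ uv ux vx]]] := step set0 (fun w => w != x).
  - by rewrite sub0set.
  - by rewrite cards0.
  - by rewrite inE.
  - by rewrite inE.
  - by rewrite eqxx.
  - by rewrite eq_sym.
  by exists v; move: ux uv; rewrite negbK => /eqP ->.
have sideE z w : P z -> w \in V -> exists s, w \in side G s [set x; z].
  move=> Pz wV; have [ws|ws] := boolP (w \in side G true [set x; z]).
    by exists true.
  by exists false; apply: sideU ws.
pose Q (zs : T * bool) := P zs.1 && (y \in side G zs.2 [set x; zs.1]).
have [zs0 Q0] : exists zs, Q zs.
  by have [s ys] := sideE z0 y Pz0 yV; exists (z0, s); rewrite /Q /= Pz0.
case: (arg_minnP (fun zs => #|side G zs.2 [set x; zs.1]|) Q0) => -[z s].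
case/andP=> /= Pz ys zmin; set e := [set x; z] in Pz ys zmin.
have pe : pair G e by apply: outerplane_pair.
have zV : z \in V by case/andP: pe => _ /subsetP; apply; rewrite set22.
have xz : x != z.
  by case/andP: pe => /eqP e2 _; apply: contra_eqN e2 => /eqP xzE;
    rewrite /e -xzE setUid cards1.
have yz : y != z by apply: contraNneq pE => yz; rewrite pxy yz.
have ye : y \notin e by rewrite in_set2 negb_or eq_sym nxy.
have [||||||u [v [uX vX uv uA vA]]] := step [set z] [pred w | (w \in side G s
  e) && (w \notin e)].
- by rewrite sub1set.
- by rewrite cards1.
- by rewrite inE.
- by rewrite inE.
- by rewrite /= set21 andbF.
- by rewrite /= ys.
move: uX vX; rewrite !in_setD !in_set1 => /andP[uz uV] /andP[vz vV].
have [t uvt] := outerplane_side Pz uv.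
move: vA => /andP[vs ve].
have tE : t = s.
  have vt : v \in side G t e by rewrite (subsetP uvt) ?set22.
  apply: contraNeq ve => ts; apply: (@sideI _ G s) => //.
  by rewrite -(bool_neq ts).
have ux : u = x.
  move: uA; rewrite /= -tE (subsetP uvt) ?set21 //= negbK in_set2 (negbTE uz)
    orbF.
  by move/eqP.
rewrite ux in uv; have Pv : P v := uv; set f := [set x; v] in uv.
have yv : y != v by apply: contraNneq pE => yv; rewrite pxy yv.
have xv : x != v by move: ve; rewrite in_set2 negb_or eq_sym => /andP[].
have sideP a b w r : a \in V -> b \in V -> w \in V -> a != b -> w != a -> w !=
  b ->
    (w \in side G r [set a; b]) =
    (((pos a < pos w < pos b) || (pos b < pos w < pos a)) == r).
  move=> aV bV wV; rewrite !(pos_eq _ aV) !(pos_eq _ wV) => ab wa wb.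
  have [lt|gt|eq] := ltngtP (pos a) (pos b).
  - rewrite in_side_set2 // (negbTE wa) (negbTE wb) /=; congr (_ == _).
    by clear -lt; lia.
  - rewrite setUC in_side_set2 // (negbTE wa) (negbTE wb) /=; congr (_ == _).
    by clear -gt; lia.
  - by rewrite eq eqxx in ab.
have ps w : w \in V -> w \in side G s0 [set x; y] by rewrite -pxy;
  apply: subsetP.
have := ps z zV; have := ps v vV; move: vs ys.
rewrite !(sideP x) // 1?eq_sym // ?[_ == x]eq_sym // ?[v == y]eq_sym ?[z ==
  y]eq_sym //.
move=> /eqP h1 /eqP h2 /eqP h3 /eqP h4.
pose r := (pos x < pos y < pos v) || (pos v < pos y < pos x).
have yr : y \in side G r f by rewrite sideP // eq_sym.
have zr : z \notin side G r f.
  rewrite sideP // 1?eq_sym // /r.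
  move: xz yz yv xv h1 h2 h3 h4 nxy vz;
    rewrite !(pos_eq _ xV) !(pos_eq _ yV) (pos_eq _ vV).
  clear; move: (pos x) (pos y) (pos z) (pos v) => px py pz pv.
  by case: s; case: s0; lia.
have := zmin (v, r); rewrite /Q /= Pv yr => /(_ isT) zle.
have pf : pair G f by apply: outerplane_pair.
have [s' es'] := outerplane_side uv Pz.
have s'E : s' = ~~ r.
  by apply: bool_neq; apply: contraNneq zr => <-; rewrite (subsetP es') ?set22.
have fe : f != e by apply: contraNneq zr => ->; rewrite inE set22 andbT.
have fs : f \subset side G s e by rewrite -tE; move: uvt; rewrite ux.
have := side_nested pf pe fe es' fs; rewrite s'E negbK => sub.
have : side G r f \proper side G s e.
  apply/properP; split=> //; exists z => //.
  by apply: (subsetP (sub_side s pe)); rewrite set22.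
by move/proper_card; rewrite ltnNge zle.
Qed.

Lemma outerplane_outerplanar : outerplanar G.
Proof.
split.
- exact: Uc.
- exact: outerplane_size.
- exact: outerplane_pair.
- exact: outerplane_side.
- exact: two_connected_outer.
Qed.

End FromDefs.

(** * Regions cut out by a set of chords *)

Section RegionGraph.
Variables (T : finType) (G : drawn_graph T).
Hypothesis hG : outerplanar G.
Implicit Types (e f S : {set T}) (x y z : T).

Local Notation V := (vertices G).
Local Notation E := (edges G).

Let Uc := circ_uniq hG.
Let ep := edge_pair hG.

Lemma pos_corners S x y : S \subset V -> x \in S -> y \in S ->
  (position (region_graph G S) x < position (region_graph G S) y) = (position G
    x < position G y).
Proof.
move=> SV xS yS; rewrite {1 2}/position /=.
have mem z : z \in S -> z \in corners G S by rewrite mem_corners.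
have lt a b : a \in S -> b \in S -> index a (corners G S) < index b (corners G
  S) ->
    position G a < position G b.
  move=> aS bS ab; rewrite -(nth_index x (mem _ bS)).
  rewrite -[X in position G X < _](nth_index x (mem _ aS)).
  by apply: (corners_sorted Uc); rewrite ab index_mem mem.
apply/idP/idP; first exact: lt.
apply: contraTT; rewrite -!leqNgt leq_eqVlt => /orP[/eqP eqi|]; last first.
  by move/(lt y x yS xS)/ltnW.
by rewrite -(nth_index x (mem _ xS)) -eqi nth_index ?mem.
Qed.

Lemma between_corners S e z : S \subset V -> e \subset S -> z \in S ->
  between (region_graph G S) e z = between G e z.
Proof.
move=> SV /subsetP eS zS; apply: eq_existsb => a; apply: andb_id2l => ae.
apply: eq_existsb => b; apply: andb_id2l => be.
by rewrite !(pos_corners SV) ?(eS a ae) ?(eS b be).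
Qed.

Lemma vertices_region S : S \subset V -> vertices (region_graph G S) = S.
Proof. by move=> SV; apply/setP => x; rewrite inE mem_corners. Qed.

Lemma side_region S s e : S \subset V -> e \subset S ->
  side (region_graph G S) s e = side G s e :&: S.
Proof.
move=> SV eS; apply/setP => z;
  rewrite [LHS]inE vertices_region // in_setI [in RHS]inE.
have [zS|] := boolP (z \in S); last by rewrite andbF.
by rewrite between_corners // (subsetP SV) // andbT.
Qed.

Variable F : {set {set T}}.
Hypothesis FE : F \subset E.

Let GF := DrawnGraph (circ G) (outer_edges G :|: F).

Lemma cut_outerplanar : outerplanar GF.
Proof.
have GFE e : e \in edges GF -> e \in E.
  by rewrite inE => /orP[/(subsetP (outer_sub hG))|/(subsetP FE)].
split.
- exact: Uc.
- exact: circ_size hG.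
- by move=> e /GFE; apply: edge_pair hG _.
- by move=> e e' /GFE eE /GFE; apply: edge_side hG _ _ eE.
- exact: subsetUl.
Qed.

Lemma region_vertices S : S \in regions G F -> S \subset V.
Proof. by move=> SF; have := face_vertices cut_outerplanar SF. Qed.

Lemma region_outerplanar S : S \in regions G F -> outerplanar (region_graph G
  S).
Proof.
move=> SF; have SV := region_vertices SF;
  have S3 := face_card cut_outerplanar SF.
have EH e : e \in edges (region_graph G S) -> e \in E /\ e \subset S.
  by rewrite inE => /andP.
split.
- exact: corners_uniq Uc S.
- by rewrite /= size_corners.
- move=> e /EH[eE eS]; rewrite /pair vertices_region // eS andbT.
  by case/andP: (ep eE).
- move=> e e' /EH[eE eS] /EH[e'E e'S]; have [s es] := edge_side hG eE e'E.
  by exists s; rewrite side_region // subsetI es.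
rewrite /outer_edges /=; move: SF; rewrite inE => /and3P[_ _ /eqP ->].
apply/subsetP => e; rewrite !inE => /andP[eo ->]; rewrite andbT.
by case/orP: eo => [/(subsetP (outer_sub hG))|/(subsetP FE)].
Qed.

Lemma region_beyond S z : S \in regions G F -> z \in V -> z \notin S ->
  exists s f, [/\ f \in F, f \subset S, S \subset side G s f & z \notin side G
    s f].
Proof.
move=> SF zV zS; have [s [f [fE fS Ss zs]]] := face_beyond cut_outerplanar SF
  zV zS.
exists s, f; split=> //; move: fE; rewrite inE => /orP[fo|//].
have /(outerP hG)[pf [s' Vs]] := fo.
have S3 := face_card cut_outerplanar SF.
case: (big_not_sub pf S3); apply: sub_both_sides Ss _.
rewrite -(_ : s' = ~~ s); first exact: subset_trans (region_vertices SF) Vs.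
by apply: bool_neq; apply: contraNneq zs => <-; apply: (subsetP Vs).
Qed.

(** To leave the region from [x], the edge would have to pass beyond a chord [f] of [F] ending at
    [x]; but then [f = g], and [f] bounds the region. *)
Lemma edge_in_region S g x : S \in regions G F -> g \in E -> x \in g -> x \in S
  ->
  (forall f, f \in F -> x \in f -> f = g) -> g \subset S.
Proof.
move=> SF gE xg xS hx; apply/subsetP => z zg.
have zV : z \in V by case/andP: (ep gE) => _ /subsetP; apply.
apply: contraT => zS; have [s [f [fF fS Ss zs]]] := region_beyond SF zV zS.
have fE := subsetP FE _ fF; have [s' gs] := edge_side hG fE gE.
have s'E : s' = ~~ s.
  by apply: bool_neq; apply: contraNneq zs => <-; apply: (subsetP gs).
have xf : x \in f.
  apply: (@sideI _ G s); first exact: (subsetP Ss).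
  by rewrite -s'E; apply: (subsetP gs).
by case/negP: zS; apply: (subsetP fS); rewrite (hx f fF xf).
Qed.

Lemma perfect_region S (Q : {set {set T}}) : S \in regions G F -> F \subset Q
  -> perfect_matching G Q ->
  perfect_matching (region_graph G S) (Q :&: edges (region_graph G S)).
Proof.
move=> SF FQ pQ; have SV := region_vertices SF; case: (pQ) => QE _.
apply: perfect_matchingP; first exact: subsetIr.
move=> x; rewrite vertices_region // => xS; have xV := subsetP SV _ xS.
have [g [gQ xg gu]] := perfect_edge pQ xV; exists g; split=> //; last first.
  by move=> h; rewrite inE => /andP[hQ _]; apply: gu.
rewrite inE gQ inE (subsetP QE) //=.
apply: (edge_in_region SF (subsetP QE _ gQ) xg xS) => f /(subsetP FQ).
exact: gu.
Qed.

End RegionGraph.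

(** * Crossings of a cycle and a path of the dual tree *)

Section Crossing.
Variables (T : finType) (G : drawn_graph T).
Hypothesis hG : outerplanar G.
Implicit Types (e f g S : {set T}) (x y z : T) (s : bool) (u v w : dual_node T).

Local Notation V := (vertices G).
Local Notation E := (edges G).
Local Notation side := (side G).
Local Notation inside := (inside G).
Local Notation faces := (inner_faces G).

Let ep := edge_pair hG.

Lemma path_side e s x q : e \in E -> path (fun y z => [set y; z] \in E) x q ->
  {in x :: q, forall y, y \notin e} -> x \in side s e ->
  {in x :: q, forall y, y \in side s e}.
Proof.
move=> eE; elim: q x => [|z q IH] x /= pq ne xs y;
  first by rewrite inE => /eqP ->.
move: pq => /andP[xz pq]; rewrite inE => /orP[/eqP -> //|].
apply: IH => // [w wq|]; first by apply: ne; rewrite inE wq orbT.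
have [s' ss'] := edge_side hG eE xz.
have -> : s = s'.
  apply: contraNeq (ne x (mem_head _ _)) => ss; apply: (@sideI _ G s) => //.
  rewrite eq_sym in ss; rewrite -(bool_neq ss).
  by apply: (subsetP ss'); rewrite set21.
by apply: (subsetP ss'); rewrite set22.
Qed.

Variable p : seq T.
Hypotheses (Up : uniq p) (sp : 2 < size p) (pE : cycle_edges p \subset E).

Lemma cycle_vertex x : x \in p -> x \in V.
Proof.
move=> xp; have := ep (subsetP pE _ (next_edge xp)).
by case/andP=> _ /subsetP; apply; rewrite set21.
Qed.

Lemma cycle_path x q i : rot i p = x :: q -> path (fun y z => [set y;
  z] \in E) x q.
Proof.
move=> rp; have Uq : uniq (x :: q) by rewrite -rp rot_uniq.
apply: sub_path (cycle_edges_path Uq) => y z; rewrite -rp cycle_edges_rot //.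
exact: (subsetP pE).
Qed.

Lemma cycle_side_avoid e s z y : e \in E -> {in p, forall x, x \notin e} ->
  z \in p -> y \in p -> z \in side s e -> y \in side s e.
Proof.
move=> eE ne zp yp zs; case: (rot_to zp) => i q rp.
have mem x : (x \in z :: q) = (x \in p) by rewrite -rp mem_rot.
apply: (path_side eE (cycle_path rp)) => // [x|]; rewrite mem //; exact: ne.
Qed.

(** Without the two ends of [e] the cycle is a path, and a path avoiding the ends of an edge stays
    on one side of it. *)
Lemma cycle_edge_side e : e \in cycle_edges p ->
  exists s, {in p, forall x, x \in side s e}.
Proof.
move=> eC; have eE := subsetP pE _ eC; case/imsetP: eC => x xp exy.
have [y [q [z [i [rp ny _]]]]] := cycle_rot Up sp xp; rewrite ny in exy.
have mem (w : T) : (w \in x :: y :: rcons q z) = (w \in p) by rewrite -rp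
  mem_rot.
have Ur : uniq (x :: y :: rcons q z) by rewrite -rp rot_uniq.
have se a s : a \in e -> a \in side s e by apply/subsetP/sub_side/ep.
have [w [q' qE]] : exists (w : T) q', rcons q z = w :: q'.
  by case: (q) => [|w q']; [exists z, [::] | exists w, (rcons q' z)].
rewrite qE in rp mem Ur.
have wV : w \in V by apply: cycle_vertex; rewrite -mem !inE eqxx !orbT.
have [s ws] : exists s, w \in side s e.
  have [ws|ws] := boolP (w \in side true e); first by exists true.
  by exists false; apply: sideU ws.
exists s => a; rewrite -mem 2!in_cons => /or3P[/eqP ->|/eqP ->|aq].
- by apply: se; rewrite exy set21.
- by apply: se; rewrite exy set22.
have /and3P[_ _ pq] := cycle_path rp.
apply: (path_side eE pq) => // b bq; rewrite exy in_set2.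
move: Ur => /and3P[xn yn _]; apply/norP; split; apply/eqP => bE.
  by move: xn; rewrite -bE in_cons bq orbT.
by move: yn; rewrite -bE bq.
Qed.

(** A step to or from a leaf copy crosses an arbitrary outer edge of the face. The default [set0]
    does not occur between adjacent nodes ([stepP]). *)
Definition step_edge u v : {set T} :=
  odflt set0 (if u.1 == v.1 then [pick e in outer_part G u.1]
              else [pick e in shared_chords G u.1 v.1]).

Variant step_spec u v : Prop :=
  | StepTip of u.1 = v.1 & u.2 = ~~ v.2 & step_edge u v \in outer_part G u.1
  | StepChord of u.1 != v.1 & u.2 = false & v.2 = false
      & step_edge u v \in shared_chords G u.1 v.1.

Lemma stepP u v : dual_adj G u v -> [/\ u.1 \in faces, v.1 \in faces &
  step_spec u v].
Proof.
case: u v => [S b] [S' b']; rewrite /dual_adj.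
rewrite ![_ \in dual_nodes G]inE /=.
case/and3P=> /andP[SF tS] /andP[SF' tS']; have [eqS|neS] := eqVneq S S'.
  move=> nb; split=> //; apply: StepTip => //=; first by rewrite (bool_neq nb).
  rewrite /step_edge /= eqS eqxx; case: pickP => //= no.
  suff : outer_part G S' = set0.
    by move: tS tS' nb; rewrite eqS => + + + o0; rewrite o0 eqxx; case: b;
      case: b'.
  by apply/setP => e; rewrite in_set0.
case/and3P=> /negbTE b0 /negbTE b0' sh; split=> //; apply: StepChord => //=.
rewrite /step_edge /= (negbTE neS); case: pickP => //= no.
by case/set0Pn: sh => e eS; have := no e; rewrite /= eS.
Qed.

(* The side of the crossed edge where the walk comes from; at a leaf copy of a *)
(* face this is the side of the outer face, which contains only the edge.      *)
Definition near_side u v : bool := inside (step_edge u v) u.1 (+) u.2.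

Lemma step_edge_sub u v : dual_adj G u v ->
  [/\ step_edge u v \in E, step_edge u v \subset u.1 & step_edge u v \subset
    v.1].
Proof.
case/stepP=> uF vF [uv _|_ _ _].
  by rewrite inE => /andP[/(subsetP (outer_sub hG)) -> eu]; rewrite -uv.
by rewrite inE => /and3P[+ -> ->]; rewrite inE => /andP[].
Qed.

(** A walk that does not turn back leaves a face by another edge than it entered, so the near sides
    grow along the walk: what is behind stays behind. *)
Lemma step_next u v w : dual_adj G u v -> dual_adj G v w -> u != w ->
  [/\ step_edge v w != step_edge u v,
      step_edge v w \subset side (~~ near_side u v) (step_edge u v),
      step_edge u v \subset side (near_side v w) (step_edge v w) &
      side (near_side u v) (step_edge u v)
        \subset side (near_side v w) (step_edge v w)].
Proof.
move=> uv vw nuw.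
have [eE eu ev] := step_edge_sub uv; have [e'E e'v e'w] := step_edge_sub vw.
have [uF vF suv] := stepP uv; have [_ wF svw] := stepP vw.
have pairE a b : a.1 = b.1 -> a.2 = b.2 -> a = b :> dual_node T.
  by case: a b => [a1 a2] [b1 b2] /= -> ->.
have v2 : v.2 = false.
  case: suv => // uv1 uv2 _; case: svw => // vw1 vw2 _.
  case/eqP: nuw; apply: pairE; first by rewrite uv1.
  by rewrite uv2 vw2 negbK.
have ne : step_edge v w != step_edge u v.
  apply/eqP => eqe; case: suv => [uv1 uv2|nuv u2 _]; rewrite inE => /andP[eo _].
    case: svw => [vw1 vw2 _|_ _ _].
      case/eqP: nuw; apply: pairE; first by rewrite uv1.
      by rewrite uv2 vw2 negbK.
    by rewrite eqe !inE eo.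
  case: svw => [vw1 vw2|nvw _ w2 _].
    by move: eo; rewrite -eqe !inE => /andP[/negbTE ->].
  have [uw1|nuw1] := eqVneq u.1 w.1.
    by case/eqP: nuw; apply: pairE => //; rewrite u2.
  have [i1 _] := share_inside hG uF vF nuv eE eu ev.
  rewrite eqe in e'E e'v e'w.
  have [i2 _] := share_inside hG vF wF nvw e'E e'v e'w.
  have [i3 _] := share_inside hG uF wF nuw1 eE eu e'w.
  by move: i3; rewrite i2 i1; case: (inside _ _).
have iv : inside (step_edge u v) v.1 = ~~ near_side u v.
  rewrite /near_side; case: suv => [uv1 uv2 _|nuv u2 _ _].
    by rewrite uv2 v2 uv1 addbT negbK.
  by rewrite u2 addbF; have [] := share_inside hG uF vF nuv eE eu ev.
have h1 : step_edge v w \subset side (~~ near_side u v) (step_edge u v).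
  by rewrite -iv; apply: subset_trans e'v (face_side hG vF eE).
have h2 : step_edge u v \subset side (near_side v w) (step_edge v w).
  by rewrite /near_side v2 addbF; apply: subset_trans ev (face_side hG vF e'E).
split=> //; rewrite -[near_side u v]negbK.
by apply: side_nested; rewrite ?ep // eq_sym.
Qed.

Fixpoint walk_cross (C : {set {set T}}) u (q : seq (dual_node T)) : nat :=
  if q is v :: q' then (step_edge u v \in C) + walk_cross C v q' else 0.

Local Notation C := (cycle_edges p).

Let edge_in_cycle g s e : g \in C -> {in p, forall x, x \in side s e} ->
  g \subset side s e.
Proof.
move=> /imsetP[x xp ->] ps; apply/subsetP => y; rewrite in_set2.
by case/orP=> /eqP ->; apply: ps; rewrite ?mem_next.
Qed.

(** The cycle is entirely behind the walk and remains so. An edge of it crossed next would lie on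
    both sides of the previous crossed edge and be equal to it. *)
Lemma walk_cross0 u v q : path (dual_adj G) u (v :: q) -> uniq (u :: v :: q) ->
  {in p, forall x, x \in side (near_side u v) (step_edge u v)} ->
  walk_cross C v q = 0.
Proof.
elim: q u v => [//|w q IH] u v pth un ps.
have [uv [vw pth']] : dual_adj G u v /\ dual_adj G v w /\ path (dual_adj G) w q.
  by move: pth => /= /and3P[].
have uw : u != w by move: un; rewrite /= !inE !negb_or => /andP[/and3P[]].
have [ne h1 h2 h3] := step_next uv vw uw.
have [eE _ _] := step_edge_sub uv; have [e'E _ _] := step_edge_sub vw.
rewrite [LHS]/= (IH v w); first 1 last.
- by rewrite /= vw.
- by case/andP: un.
- by move=> x /ps; apply: (subsetP h3).
rewrite addn0; apply/eqP; rewrite eqb0; apply: contra ne => e'C; apply/eqP.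
apply: (pair_inj (ep e'E) (ep eE)).
exact: sub_both_sides (edge_in_cycle e'C ps) h1.
Qed.

(** At the next crossing the cycle lies on one side of the crossed edge. It is the near side,
    because [g] is already behind; then [walk_cross0] applies. *)
Lemma walk_cross1 u v q g : path (dual_adj G) u (v :: q) -> uniq (u :: v :: q)
  ->
  g \in C -> g \subset side (near_side u v) (step_edge u v) ->
  walk_cross C v q <= 1.
Proof.
elim: q u v => [//|w q IH] u v pth un gC gs.
have [uv [vw pth']] : dual_adj G u v /\ dual_adj G v w /\ path (dual_adj G) w q.
  by move: pth => /= /and3P[].
have uw : u != w by move: un; rewrite /= !inE !negb_or => /andP[/and3P[]].
have [ne h1 h2 h3] := step_next uv vw uw.
have [eE _ _] := step_edge_sub uv; have [e'E _ _] := step_edge_sub vw.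
have pth2 : path (dual_adj G) v (w :: q) by rewrite /= vw.
have un2 : uniq (v :: w :: q) by case/andP: un.
have gs' := subset_trans gs h3.
rewrite [X in X <= _]/=; have [e'C|e'C] := boolP (step_edge v w \in C);
  last first.
  exact: IH pth2 un2 gC gs'.
have [s ps] := cycle_edge_side e'C.
rewrite (walk_cross0 pth2 un2) ?addn0 //.
suff <- : s = near_side v w by [].
apply: contraNeq ne => ns; apply/eqP/(pair_inj (ep e'E) (ep eE)).
apply: sub_both_sides h1.
suff <- : g = step_edge v w by [].
apply: (pair_inj (ep (subsetP pE _ gC)) (ep e'E)).
apply: sub_both_sides gs' _; rewrite -(bool_neq ns).
exact: edge_in_cycle ps.
Qed.

Lemma walk_cross2 u q : path (dual_adj G) u q -> uniq (u :: q) -> walk_cross C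
  u q <= 2.
Proof.
elim: q u => [//|v q IH] u pth un /=.
have [uv pth'] : dual_adj G u v /\ path (dual_adj G) v q by move: pth => /=
  /andP.
have [eC|eC] := boolP (step_edge u v \in C); last first.
  by apply: IH => //; case/andP: un.
apply: (walk_cross1 pth un eC); apply: sub_side.
by apply: ep; apply: (subsetP pE).
Qed.

End Crossing.

(** * The two bounds *)

Section LowerBound.
Variables (T : finType) (G : drawn_graph T).
Hypothesis hG : outerplanar G.
Implicit Types (e f g S : {set T}) (x y z : T).

Local Notation V := (vertices G).
Local Notation E := (edges G).

Variables (M N : {set {set T}}) (t : nat) (Ms : nat -> {set {set T}}).
Hypotheses (Ms0 : Ms 0 = M) (Mst : Ms t = N).
Hypothesis pMs : forall i, i <= t -> perfect_matching G (Ms i).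
Hypothesis aMs : forall i, i < t -> exists C,
  alternating_cycle G (Ms i) C /\ Ms i.+1 = symdiff (Ms i) C.

Let Cs i := symdiff (Ms i) (Ms i.+1).

Let alt i : i < t -> alternating_cycle G (Ms i) (Cs i).
Proof. by move=> /aMs[C [aC eqC]]; rewrite /Cs eqC symdiff_symdiff. Qed.

Definition fixed_chords : {set {set T}} :=
  [set e in common_chords G M N | [forall i : 'I_t.+1, e \in Ms i]].

Local Notation F := fixed_chords.
Local Notation H S := (region_graph G S).

Lemma fixed_sub : F \subset common_chords G M N.
Proof. by apply/subsetP => e; rewrite inE => /andP[]. Qed.

Let FE : F \subset E.
Proof.
apply/subsetP => e /(subsetP fixed_sub).
by rewrite !inE => /andP[/andP[/andP[]]].
Qed.

Let FMs i e : i <= t -> e \in F -> e \in Ms i.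
Proof.
rewrite inE -ltnS => it /andP[_ /forallP h]; exact: (h (Ordinal it)).
Qed.

Let GF_outerplanar := cut_outerplanar hG FE.

(** At an end of a chord of [F] the matching edge is that chord, which is not flipped, so the cycle
    avoids the vertex. Hence it cannot get from one side of the chord to the other. *)
Lemma cycle_in_region S i e : S \in regions G F -> i < t -> e \in Cs i ->
  e \in edges (H S) -> e \notin F -> Cs i \subset edges (H S).
Proof.
move=> SF it eC eH eF; have [p [Up sp Cp CE aC]] := alt it.
have SV := region_vertices hG FE SF.
have pS x : x \in p -> x \in S.
  move=> xp; apply: contraT => xS.
  have xV : x \in V by apply: (cycle_vertex hG _ xp); rewrite -Cp.
  have [s [f [fF fS Ss xs]]] := region_beyond hG FE SF xV xS.
  have fE := subsetP FE _ fF.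
  have avoid y : y \in p -> y \notin f.
    move=> yp; apply/negP => yf.
    have yV : y \in V by apply: (cycle_vertex hG _ yp); rewrite -Cp.
    have [g [_ _ gu]] := perfect_edge (pMs (ltnW it)) yV.
    have fg := gu f (FMs (ltnW it) fF) yf.
    have aux h : h \in Ms i -> y \in h -> h \notin cycle_edges p.
      move=> hM yh; rewrite (gu h hM yh) -fg -Cp in_symdiff.
      by rewrite (FMs (ltnW it) fF) (FMs it fF).
    have := aC y yp; have [aM|aM] := boolP ([set y; next p y] \in Ms i).
      by have := aux _ aM (set21 _ _); rewrite next_edge.
    move/esym/negbFE => bM; have := aux _ bM (set22 _ _).
    by rewrite prev_edge.
  move: eC; rewrite Cp => /imsetP[u up euv].
  have uS : u \in S.
    by move: eH; rewrite inE euv => /andP[_ /subsetP]; apply; rewrite set21.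
  case/negP: xs; rewrite Cp in CE.
  exact: (cycle_side_avoid hG Up CE fE avoid up xp (subsetP Ss _ uS)).
apply/subsetP => g gC; rewrite inE (subsetP CE) //=.
move: gC; rewrite Cp => /imsetP[u up ->]; apply/subsetP => y.
by rewrite in_set2 => /orP[] /eqP ->; apply: pS; rewrite ?mem_next.
Qed.

Definition region_steps S : {set 'I_t} := [set i : 'I_t | Cs i \subset edges (H
  S)].

Lemma flip_between e a b : a <= b -> (e \in Ms a) != (e \in Ms b) ->
  exists2 i, a <= i < b & e \in Cs i.
Proof.
elim: b => [|b IH]; first by rewrite leqn0 => /eqP ->; rewrite eqxx.
rewrite leq_eqVlt => /orP[/eqP ->|]; first by rewrite eqxx.
rewrite ltnS => ab ne; have [eC|] := boolP (e \in Cs b).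
  by exists b; rewrite // ab ltnSn.
rewrite in_symdiff => eqb; have [|i /andP[ai ib] eC] := IH ab.
  by move: ne eqb; case: (e \in Ms a); case: (e \in Ms b);
    case: (e \in Ms b.+1).
by exists i; rewrite // ai ltnW.
Qed.

Lemma flips_ge1 S e : S \in regions G F -> e \in edges (H S) -> e \notin F ->
  (e \in M) != (e \in N) -> 0 < \sum_(i in region_steps S) (e \in Cs i).
Proof.
move=> SF eH eF ne; have [|i /andP[_ it] eC] := @flip_between e 0 t (leq0n _).
  by rewrite Ms0 Mst.
rewrite (bigD1 (Ordinal it)) /= ?eC //.
by rewrite inE (cycle_in_region SF it eC eH eF).
Qed.

(** The chord is missing at some time [j]: it is removed before and reinserted after. *)
Lemma flips_ge2 S e : S \in regions G F -> e \in edges (H S) -> e \notin F ->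
  e \in inner_edges G -> e \in M -> e \in N ->
  1 < \sum_(i in region_steps S) (e \in Cs i).
Proof.
move=> SF eH eF ei eM eN.
have [j jt ej] : exists2 j, j <= t & e \notin Ms j.
  move: eF; rewrite !inE in ei *;
    rewrite ei eM eN /= negb_forall => /existsP[j ej].
  by exists j => //; rewrite -ltnS.
have [|i /andP[_ ij] iC] := @flip_between e 0 j (leq0n _).
  by rewrite Ms0 eM (negbTE ej).
have [|k /andP[jk kt] kC] := @flip_between e j t jt.
  by rewrite Mst eN (negbTE ej).
have it := leq_trans ij jt.
have iS : Ordinal it \in region_steps S by rewrite inE (cycle_in_region SF it
  iC).
have kS : Ordinal kt \in region_steps S by rewrite inE (cycle_in_region SF kt
  kC).
rewrite (bigD1 (Ordinal it)) //= iC (bigD1 (Ordinal kt)) /= ?kC //.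
by rewrite kS -val_eqE /= neq_ltn (leq_trans ij jk) orbT.
Qed.

Lemma region_chord S e : S \in regions G F -> e \in inner_edges (H S) ->
  e \notin F /\ e \in inner_edges G.
Proof.
move=> SF ei; have hH := region_outerplanar hG FE SF.
have SV := region_vertices hG FE SF.
move: (ei); rewrite inE => /andP[eo eH].
have /andP[eE eS] : (e \in E) && (e \subset S) by move: eH; rewrite inE.
have outS : e \in outer_edges G :|: F -> e \in outer_edges (H S).
  move=> eGF; move: (SF); rewrite inE => /and3P[_ _ /eqP eqS].
  by rewrite /outer_edges /= eqS inE eGF.
split; first by apply: contra eo => eF; apply: outS; rewrite inE eF orbT.
by rewrite inE eE andbT; apply: contra eo => eF; apply: outS; rewrite inE eF.
Qed.

Lemma dual_length_leq S u v : S \in regions G F -> dual_adj (H S) u v ->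
  dual_length (H S) (M :&: edges (H S)) (N :&: edges (H S)) u v <=
  \sum_(i in region_steps S) (step_edge (H S) u v \in Cs i).
Proof.
move=> SF uv; have hH := region_outerplanar hG FE SF.
have [eE eu ev] := step_edge_sub hH uv.
have [uF vF [uv1 _ eo|nuv u2 v2 es]] := stepP uv.
  rewrite /dual_length uv1 eqxx; have [/subsetP sub|//] := boolP (_ \subset _).
  rewrite uv1 in eo; have := sub _ eo;
    rewrite in_symdiff !in_setI eE !andbT => d.
  apply: flips_ge1 => //; last by case: (_ \in M) (_ \in N) d => [] [].
  by apply/negP => /(subsetP fixed_sub);
    rewrite !in_setI => /andP[/andP[_ eM] eN];
    rewrite eM eN in d.
have ei : step_edge (H S) u v \in inner_edges (H S) by move: es;
  rewrite inE => /andP[].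
have [eF eiG] := region_chord SF ei.
have -> : dual_length (H S) (M :&: edges (H S)) (N :&: edges (H S)) u v =
    (step_edge (H S) u v \in M) + (step_edge (H S) u v \in N).
  move: u2 v2 nuv uF vF eu ev eE; move: (step_edge _ u v) => e.
  case: (u) (v) => [S1 b1] [S2 b2] /= -> -> ne F1 F2 e1 e2 eE.
  by rewrite (dual_length_share hH _ _ F1 F2 ne eE e1 e2) !in_setI eE !andbT.
have := flips_ge2 SF eE eF eiG; have := flips_ge1 SF eE eF.
case: (_ \in M); case: (_ \in N) => //= h1 h2.
- exact: h2.
- exact: h1.
- exact: h1.
Qed.

Lemma gap_leq S : S \in regions G F ->
  gap (H S) (M :&: edges (H S)) (N :&: edges (H S)) <= 2 * #|region_steps S|.
Proof.
move=> SF; have hH := region_outerplanar hG FE SF.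
apply/bigmax_leqP => u _; apply/bigmax_leqP => v _; apply/bigmax_leqP => q dq.
have /and3P[pq _ uq] := dq.
apply: (@leq_trans (\sum_(i in region_steps S) walk_cross (H S) (Cs i) u q)).
  clear dq uq; elim: (bseqval q) u pq => [|w q' IH] {}u /=;
    first by rewrite big1.
  case/andP=> uw pq'; rewrite big_split /=.
  by apply: leq_add; [apply: dual_length_leq | apply: IH].
rewrite mulnC -sum_nat_const; apply: leq_sum => i; rewrite inE => iS.
have [p [Up sp Cp _ _]] := alt (ltn_ord i).
by rewrite Cp; apply: walk_cross2 => //; rewrite -Cp.
Qed.

(** Two regions share at most the two ends of a chord, while a cycle has at least three vertices. *)
Lemma sum_region_steps : \sum_(S in regions G F) #|region_steps S| <= t.
Proof.
have -> : \sum_(S in regions G F) #|region_steps S| =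
    \sum_(S in regions G F) \sum_(i < t) (Cs i \subset edges (H S)).
  apply: eq_bigr => S _; rewrite -sum1_card big_mkcond /=;
    apply: eq_bigr => i _.
  by rewrite inE; case: (_ \subset _).
rewrite exchange_big /= -[X in _ <= X]card_ord -sum1_card;
  apply: leq_sum => i _.
have [p [Up sp Cp CE _]] := alt (ltn_ord i).
have pS S x : Cs i \subset edges (H S) -> x \in p -> x \in S.
  move=> /subsetP sub xp; have := sub [set x; next p x].
  rewrite Cp next_edge // => /(_ isT); rewrite inE => /andP[_ /subsetP]; apply.
  by rewrite set21.
pose A := [set S | Cs i \subset edges (H S)].
have -> : \sum_(S in regions G F) (Cs i \subset edges (H S)) = #|A :&: regions
  G F|.
  by rewrite cardsI_sum; apply: eq_bigr => S _; rewrite inE.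
apply/card_le1_eqP => S S'; rewrite !in_setI ![_ \in A]inE.
move=> /andP[SC SF] /andP[SC' SF'].
apply/eqP; apply: contraT; rewrite eq_sym => ne.
have [f [fi _ sf]] := face_sep GF_outerplanar SF SF' ne.
have fE : f \in outer_edges G :|: F by move: fi; rewrite inE => /andP[].
have pf := edge_pair GF_outerplanar fE.
have : #|[set x in p]| <= #|f|.
  apply/subset_leq_card/subsetP => x; rewrite inE => xp.
  apply: (@sideI _ G (inside G f S)).
    exact: (subsetP (face_side GF_outerplanar SF fE)) (pS _ _ SC xp).
  rewrite -(bool_neq (_ : inside G f S' != inside G f S));
    last by rewrite eq_sym.
  exact: (subsetP (face_side GF_outerplanar SF' fE)) (pS _ _ SC' xp).
case/andP: pf => /eqP -> _; rewrite cardsE (card_uniqP Up).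
by rewrite leqNgt sp.
Qed.

Lemma gap_sum_leq : gap_sum G M N F <= t.*2.
Proof.
rewrite -muln2 mulnC; apply: leq_trans (_ : 2 * \sum_(S in regions G F)
  #|region_steps S| <= _).
  by rewrite big_distrr; apply: leq_sum => S SF; apply: gap_leq.
by rewrite leq_mul2l sum_region_steps.
Qed.

End LowerBound.

(** * Upper bound: treating the regions one after another *)

Section UpperBound.
Variables (T : finType) (G : drawn_graph T).
Hypothesis hG : outerplanar G.
Implicit Types (e f g S : {set T}) (x y z : T).

Local Notation V := (vertices G).
Local Notation E := (edges G).
Local Notation H S := (region_graph G S).

Let ep := edge_pair hG.

Variables (M N F : {set {set T}}).
Hypotheses (pM : perfect_matching G M) (pN : perfect_matching G N).
Hypothesis FC : F \subset common_chords G M N.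
Hypothesis hchord : inner_edges G = set0 -> M = N.

Let FP e : e \in F -> [/\ e \in E, e \in M & e \in N].
Proof.
by move/(subsetP FC); rewrite !in_setI => /andP[/andP[]];
  rewrite inE => /andP[].
Qed.

Let FE : F \subset E. Proof. by apply/subsetP => e /FP[]. Qed.
Let FM : F \subset M. Proof. by apply/subsetP => e /FP[]. Qed.
Let FN : F \subset N. Proof. by apply/subsetP => e /FP[]. Qed.

Let GF_outerplanar := cut_outerplanar hG FE.

Lemma outer_region S e : S \in regions G F ->
  (e \in outer_edges (H S)) = (e \in outer_edges G :|: F) && (e \subset S).
Proof. by rewrite inE => /and3P[_ _ /eqP eqS];
  rewrite /outer_edges /= eqS inE. Qed.

(** A bounding chord of [F] lies in both matchings. If there is none, the region is all of [V], so a
    chord of [G] would be an inner edge of it; with no chord at all, [hchord] gives [M = N]. *)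
Lemma region_not_cycle S : S \in regions G F -> inner_edges (H S) = set0 ->
  exists2 e, e \in outer_edges (H S) &
    (e \in M :&: edges (H S)) = (e \in N :&: edges (H S)).
Proof.
move=> SF no; have SV := region_vertices hG FE SF.
have S3 := face_card GF_outerplanar SF.
have [x xS] : exists x, x \in S by apply/set0Pn; rewrite -card_gt0;
  apply: ltn_trans S3.
have [MN|MN] := eqVneq M N.
  by exists [set x; next (corners G S) x];
    rewrite ?MN // next_edge ?mem_corners.
have [c ci] : exists c, c \in inner_edges G.
  by apply/set0Pn; apply: contra MN => /eqP /hchord ->.
have fixed f : f \in F -> f \subset S -> exists2 e, e \in outer_edges (H S) &
    (e \in M :&: edges (H S)) = (e \in N :&: edges (H S)).
  move=> fF fS; exists f; first by rewrite outer_region // in_setU fF orbT.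
  by rewrite !in_setI (subsetP FM) // (subsetP FN).
have beyond z : z \in V -> z \notin S -> exists2 e, e \in outer_edges (H S) &
    (e \in M :&: edges (H S)) = (e \in N :&: edges (H S)).
  move=> zV zS; have [s [f [fF fS _ _]]] := region_beyond hG FE SF zV zS.
  exact: fixed fF fS.
have [VS|/subsetPn[z zV zS]] := boolP (V \subset S); last exact: beyond zV zS.
have cE : c \in E by move: ci; rewrite inE => /andP[].
have cS : c \subset S by apply: subset_trans VS; case/andP: (ep cE).
have [cF|cF] := boolP (c \in F); first exact: fixed cF cS.
have : c \in inner_edges (H S).
  rewrite inE outer_region // in_setU (negbTE cF) orbF cS andbT.
  by move: ci; rewrite inE => /andP[-> _]; rewrite inE cE cS.
by rewrite no inE.
Qed.

Lemma alternating_lift S (Q Q' C : {set {set T}}) : edges (H S) \subset E ->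
  (forall e, e \in edges (H S) -> (e \in Q) = (e \in Q')) ->
  alternating_cycle (H S) Q' C -> alternating_cycle G Q C.
Proof.
move=> HE QQ [p [Up sp Cp CE aC]]; exists p; split=> //;
  first exact: subset_trans HE.
move=> x xp; rewrite !QQ ?aC //; apply: (subsetP CE); rewrite Cp.
  exact: prev_edge.
exact: next_edge.
Qed.

Lemma region_edges_sub S : edges (H S) \subset E.
Proof. by apply/subsetP => e; rewrite inE => /andP[]. Qed.

Lemma reconfigure_lift S (Q N' : {set {set T}}) t0 t1 : reconfigures_in G M Q
  t0 ->
  reconfigures_in (H S) (Q :&: edges (H S)) N' t1 ->
  reconfigures_in G M ((Q :\: edges (H S)) :|: N') (t0 + t1).
Proof.
move=> rQ [Ms [M0 Mt pMs aMs]]; rewrite -Mt.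
have sub i : i <= t1 -> Ms i \subset edges (H S) by move=> /pMs[].
suff main i : i <= t1 -> reconfigures_in G M ((Q :\: edges (H S)) :|: Ms i) (t0
  + i).
  exact: main.
elim: i => [_|i IH it]; first by rewrite M0 addn0 setUC setID.
have [C [aC ->]] := aMs i it; rewrite addnS.
have -> : (Q :\: edges (H S)) :|: symdiff (Ms i) C =
    symdiff ((Q :\: edges (H S)) :|: Ms i) C.
  apply/setP => e; rewrite [RHS]in_symdiff [LHS]in_setU in_symdiff in_setU
    in_setD.
  have [eH|eH] := boolP (e \in edges (H S)) => //=.
  have -> : e \in C = false.
    by apply: contraNF eH; case: aC => p [_ _ _ /subsetP sC _]; apply: sC.
  by rewrite !addbF.
apply: reconfigures_step; first exact: IH (ltnW it).
apply: (alternating_lift (region_edges_sub S)) aC => e eH.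
by rewrite in_setU in_setD eH.
Qed.

(** The matching once the regions in [rs] are done. Overlaps are harmless: regions share only chords
    of [F] ([region_share]), where [M] and [N] agree. *)
Let Q (rs : seq {set T}) : {set {set T}} :=
  [set e | if has (fun S => e \in edges (H S)) rs then e \in N else e \in M].

Lemma region_share S S' e : S \in regions G F -> S' \in regions G F -> S != S'
  ->
  e \in edges (H S) -> e \in edges (H S') -> e \in F.
Proof.
move=> SF SF' ne; rewrite !inE => /andP[eE eS] /andP[_ eS'].
have [f [fi _ sf]] := face_sep GF_outerplanar SF SF' ne.
move: fi; rewrite inE => /andP[fo fGF].
have fF : f \in F by move: fGF; rewrite inE => /orP[fo'|//]; rewrite fo' in fo.
suff -> : e = f by [].
apply: (pair_inj (ep eE) (ep (subsetP FE _ fF))).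
apply: (@sub_both_sides _ G (inside G f S)).
  exact: subset_trans eS (face_side GF_outerplanar SF fGF).
rewrite -(bool_neq (_ : inside G f S' != inside G f S)); last by rewrite eq_sym.
exact: subset_trans eS' (face_side GF_outerplanar SF' fGF).
Qed.

Lemma reconfigure_regions rs : uniq rs -> {subset rs <= regions G F} ->
  exists2 t, t.*2 <= \sum_(S <- rs) gap (H S) (M :&: edges (H S)) (N :&: edges
    (H S))
    & reconfigures_in G M (Q rs) t.
Proof.
elim: rs => [_ _|S rs IH].
  exists 0; rewrite ?big_nil // (_ : Q [::] = M);
    first exact: reconfigures_refl.
  by apply/setP => e; rewrite inE.
case/andP=> Srs Urs sub; have SF : S \in regions G F by apply: sub;
  rewrite mem_head.
have [t tle rt] : exists2 t, t.*2 <= \sum_(S <- rs) gap (H S) (M :&: edges (H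
  S))
    (N :&: edges (H S)) & reconfigures_in G M (Q rs) t.
  by apply: IH => // S' S'rs; apply: sub; rewrite inE S'rs orbT.
have pMH := perfect_region hG FE SF FM pM;
  have pNH := perfect_region hG FE SF FN pN.
have [t1 t1le rt1] := reconfigure_half_gap (region_outerplanar hG FE SF) pMH pNH
  (region_not_cycle SF).
exists (t + t1); first by rewrite big_cons doubleD addnC leq_add.
have shared e : e \in edges (H S) -> has (fun S => e \in edges (H S)) rs -> e
  \in F.
  move=> eS /hasP[S' S'rs eS']; apply: (region_share SF _ _ eS eS').
    by apply: sub; rewrite inE S'rs orbT.
  by apply: contraNneq Srs => ->.
have QH : Q rs :&: edges (H S) = M :&: edges (H S).
  apply/setP => e; rewrite !in_setI [_ \in Q rs]inE.
  have [eS|] := boolP (e \in edges (H S)); rewrite ?andbF // !andbT.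
  by case: ifP => // /(shared e eS) eF; rewrite (subsetP FM) // (subsetP FN).
rewrite -QH in rt1; have := reconfigure_lift rt rt1.
congr (reconfigures_in _ _ _ _); apply/setP => e.
rewrite in_setU in_setD in_setI ![_ \in Q _]inE /=.
have [eS|eS] := boolP (e \in edges (H S)); first by rewrite andbT.
by rewrite andbF orbF.
Qed.

Lemma vertex_region x : x \in V -> exists2 S, S \in regions G F & x \in S.
Proof.
move=> xV; pose e := [set x; next (circ G) x].
have eo : e \in outer_edges G by apply: next_edge; rewrite inE in xV.
have eF : e \in outer_edges G :|: F by rewrite inE eo.
have [S SF eS] := edge_face GF_outerplanar eF.
by exists S => //; apply: (subsetP eS); rewrite set21.
Qed.

Lemma reconfigure_cut :
  exists2 t, t.*2 <= gap_sum G M N F & reconfigures_in G M N t.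
Proof.
have [S|t tle rt] := @reconfigure_regions (enum (regions G F)) (enum_uniq _).
  by rewrite mem_enum.
exists t; first by move: tle; rewrite big_enum.
move: rt; set P := Q _ => rt.
have pP : perfect_matching G P by case: rt => Ms [_ <- + _]; apply.
suff <- : P = N by [].
(* Every edge of [N] lies in some region, so [P] contains [N]; as both are perfect, they
   coincide. *)
have NP x h : x \in V -> h \in N -> x \in h -> h \in P.
  move=> xV hN xh; have [S SF xS] := vertex_region xV.
  have hE : h \in E by case: pN => /subsetP sub _; apply: sub.
  have [g [_ _ gu]] := perfect_edge pN xV.
  have hS : h \subset S.
    apply: (edge_in_region hG FE SF hE xh xS) => f fF xf.
    by rewrite (gu f (subsetP FN _ fF) xf) (gu h).
  rewrite inE; case: hasP => // -[]; exists S; first by rewrite mem_enum.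
  by rewrite inE hE.
have edge_vertex (A : {set {set T}}) e : perfect_matching G A -> e \in A ->
    exists2 x, x \in V & x \in e.
  case=> /subsetP sub _ /sub/ep/pairP[a [b [-> aV _ _]]].
  by exists a; rewrite ?set21.
apply/eqP; rewrite eqEsubset; apply/andP; split; apply/subsetP => e eA.
  have [x xV xe] := edge_vertex P e pP eA.
  have [h [hN xh _]] := perfect_edge pN xV.
  have [g [_ _ gu]] := perfect_edge pP xV.
  by rewrite (gu e eA xe) -(gu h (NP x h xV hN xh) xh).
by have [x xV xe] := edge_vertex N e pN eA; apply: NP xV eA xe.
Qed.

End UpperBound.

Local Open Scope ring_scope.

Theorem theorem3 (T : finType) (G : drawn_graph T) (M N : {set {set T}})
    (hG : outerplane G) (hG2 : two_connected G)
    (hM : perfect_matching G M) (hN : perfect_matching G N)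
    (hchord : inner_edges G = set0 -> M = N) :
  exists t : nat,
    is_OPT G M N t /\ t%:R = 2^-1 * (min_gap_sum G M N)%:R :> rat.
Proof.
have oG := outerplane_outerplanar hG hG2.
rewrite /min_gap_sum; case: arg_minnP => [|F FC Fmin]; first by rewrite sub0set.
have lower t : reconfigures_in G M N t -> (gap_sum G M N F <= t.*2)%N.
  case=> Ms [M0 Mt pMs aMs].
  (* The minimiser [F] is compared with the chords that this sequence keeps matched. *)
  apply: leq_trans (Fmin _ (fixed_sub G M N t Ms)) _.
  exact: (gap_sum_leq oG M0 Mt pMs aMs).
have [t tle rt] := reconfigure_cut oG hM hN FC hchord.
have tE : gap_sum G M N F = t.*2 by apply/eqP; rewrite eqn_leq tle lower.
exists t; split.
  by split=> // t' /lower; rewrite tE leq_double.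
rewrite tE -mul2n GRing.natrM GRing.mulKf //.
Qed.
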